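(* There are only finitely many pairs of positive integers $(m,n)$ such that $|\tau(m!)|=n!$, and they are effectively computable (i.e., there is an effectively computable bound on $m$ and $n$ for all such pairs).
   Context: $\tau(n)$ denotes the Ramanujan function, defined by the power series identity $X\prod_{n=1}^\infty(1-X^n)^{24}=\sum_{n=1}^\infty \tau(n)X^n$ for $|X|<1$. *)

(* Defs.v *)
From mathcomp Require Import all_boot all_order all_algebra.

Set Implicit Arguments.
Unset Strict Implicit.
Unset Printing Implicit Defensive.

Import GRing.Theory.
Local Open Scope ring_scope.

Definition delta_trunc (N : nat) : {poly int} :=
  'X * \prod_(1 <= k < N.+1) (1 - 'X^k) ^+ 24.

(* The factors with k > n do not affect the coefficient of X^n, so this is the
   n-th coefficient of the infinite product X * prod_(k >= 1) (1 - X^k)^24;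
   see [coef_delta_trunc]. *)
Definition tau (n : nat) : int := (delta_trunc n)`_n.

Lemma coef_delta_trunc (N n : nat) :
  (n <= N)%N -> (delta_trunc N)`_n = tau n.
Proof.
elim: N => [|N IH]; first by rewrite leqn0 => /eqP ->.
rewrite leq_eqVlt => /orP[/eqP -> //|]; rewrite ltnS => le_nN.
rewrite -IH // /delta_trunc big_nat_recr //= mulrA.
set P := 'X * _.
have [q ->] : exists q : {poly int}, (1 - 'X^(N.+1)) ^+ 24 = 1 + q * 'X^(N.+1).
  elim: 24%N => [|j [q Eq]]; first by exists 0; rewrite expr0 mul0r addr0.
  exists (q - 1 - q * 'X^(N.+1)); rewrite exprSr Eq.
  rewrite mulrBr mulr1 [in RHS]mulrBl mulrBl mul1r mulrDl mul1r opprD !addrA.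
  by congr (_ - _).
by rewrite mulrDr mulr1 mulrA coefD coefMXn ltnS le_nN addr0.
Qed.

(* Main.v *)
Require Import Defs.
From mathcomp Require Import all_boot all_order all_algebra all_field.
From mathcomp Require Import zify ring lra.

(** Write v for the exponent of 2 in m! and N = v + 1. The Hecke relation at 2
    gives tau(2^v h) = 8^v w_N tau(h) for odd h, where w is the Lucas sequence
    of X^2 + 3X + 32, so w_N divides n!; moreover n = O(m) = O(N), because
    |tau(k)| grows polynomially. A prime q dividing w_N with rank of apparition
    z | N satisfies q = 0, 1 or -1 modulo z and occurs in n! with exponent about
    n / q; primes of rank at most sqrt N contribute at most
    N * prod_(z | N, z <= sqrt N) |w_z|. Together this yields |w_N| <= 2^(o(N)).
    On the other hand x^2 + 119 w_N^2 = 2^(5N+2) for some integer x, so 2^(5N+2)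
    would be extremely close to a square. Beukers' Pade approximations to
    sqrt(1 - z) at z = 7 / 2^15 = 1 - 181^2 / 2^15 rule this out effectively.

    The Hecke relation comes from Jacobi's identity
    theta3(y)^4 - theta3(-y)^4 = 16 y psi(y^2)^4 together with Gauss' product
    formulas, and the polynomial bound from prod (1 - y^k)^3 = theta3(-y)^2 psi(y). *)

Set Implicit Arguments.
Unset Strict Implicit.
Unset Printing Implicit Defensive.

Import Order.TTheory GRing.Theory Num.Theory.

Local Open Scope ring_scope.

(** * The gap between squares and powers of 2 *)

(** The prime 2 suffices because its exponent in m! is at least m/2 rounded down, so m, n and N stay
    comparable. The difficulty is an effective lower bound for |w_N|, normally of size 32^(N/2) but
    with no evident reason not to be tiny. X^2 + 3X + 32 has discriminant -119, and completing the
    square in its norm form turns a tiny w_N into a square close to 2^(5N+2). The even powers of 2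
    are harmless; for the odd ones the Pade method gives a gap of at least 2^(n/50) below 2^n. The
    exponent 1/50 fixes the target of the upper bound: |w_N|^25 <= 2^N makes the 50th power of 119
    w_N^2 about 2^(4N), less than 2^(5N+2).

    Power series are never formed. Theta functions and products are finite expressions at an element
    y with y^M = 0 of a commutative ring: tails vanish there, and the products are cancellable
    though no inverse is named. Coefficients are then read off modulo X^(m+1). The coefficients are
    taken in [algC] because the route to Jacobi's identity substitutes i y for y. *)

Lemma dvdz_prod_shift (h x k s : int) (d : nat) :
  (h %| \prod_(t < d) (x + k * h + s * t%:Z) - \prod_(t < d) (x + s * t%:Z))%Z.
Proof.
elim/big_rec2: _ => [|t u v _ IH]; first by rewrite subrr dvdz0.
have -> : (x + k * h + s * t%:Z) * v - (x + s * t%:Z) * u =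
   (k * v) * h + (x + s * t%:Z) * (v - u) by ring.
by rewrite rpredD // dvdz_mull.
Qed.

Lemma dvdz_shift_prod (h x k s : int) (d : nat) :
  (h %| \prod_(t < d) (x + k * h + s * t%:Z))%Z ->
  (h %| \prod_(t < d) (x + s * t%:Z))%Z.
Proof.
move=> dv; rewrite -[X in (_ %| X)%Z](subKr (\prod_(t < d) (x + k * h + s * t%:Z))).
by rewrite rpredB // dvdz_prod_shift.
Qed.

(** Translating c by a multiple of d! does not change the product modulo d!, so c may be taken
    nonnegative; the quotient is then a binomial coefficient. *)
Lemma fact_dvd_prod_consecutive (d : nat) (c : int) :
  (d`!%:Z %| \prod_(t < d) (c + t%:Z))%Z.
Proof.
case: d => [|d]; first by rewrite big_ord0.
pose h := d.+1`!%:Z; have h_gt0 : 0 < h by rewrite ltz_nat fact_gt0.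
suff : (h %| \prod_(t < d.+1) (c + `|c|%N%:Z * h + 1 * t%:Z))%Z.
  by move/dvdz_shift_prod; under eq_bigr do rewrite mul1r.
have [m ->] : exists m : nat, c + `|c|%N%:Z * h = m%:Z.
  exists (absz (c + (absz c)%:Z * h)); apply/esym/gez0_abs.
  have : (absz c)%:Z * 1 <= (absz c)%:Z * h by apply: ler_wpM2l; rewrite // -gtz0_ge1.
  have : 0 <= c + (absz c)%:Z by lia. move: ((absz c)%:Z * h) => u; lia.
have -> : \prod_(t < d.+1) (m%:Z + 1 * t%:Z) = (\prod_(t < d.+1) (m + t))%N%:Z.
  rewrite (big_morph Posz PoszM (erefl _)).
  by apply: eq_bigr => t _; rewrite mul1r PoszD.
rewrite dvdzE /=; case: m => [|m]; first by rewrite big_ord_recl /= dvdn0.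
have -> : (\prod_(t < d.+1) (m.+1 + t) = (m + d.+1) ^_ d.+1)%N.
  rewrite ffact_prod [RHS](reindex_inj rev_ord_inj) /=.
  by apply: eq_bigr => t _; have := ltn_ord t; lia.
by rewrite -bin_ffact dvdn_mull.
Qed.

Lemma prod_step2_even (d : nat) (c : int) :
  \prod_(t < d) (2 * c + 2 * t%:Z) = 2 ^+ d * \prod_(t < d) (c + t%:Z) :> int.
Proof.
rewrite -[X in 2 ^+ X]card_ord -prodr_const -big_split /=.
by apply: eq_bigr => t _; rewrite mulrDr.
Qed.

Lemma logn2_fact_le (d : nat) : (logn 2 d`! <= d)%N.
Proof.
elim/ltn_ind: d => -[|d] IH //.
rewrite logn_fact //.
have -> : (\sum_(1 <= k < d.+2) d.+1 %/ 2 ^ k =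
   d.+1 %/ 2 + \sum_(1 <= k < d.+1) (d.+1 %/ 2) %/ 2 ^ k)%N.
  rewrite big_nat_recl //= expn1; congr addn.
  by apply: eq_bigr => k _; rewrite expnS divnMA.
have -> : (\sum_(1 <= k < d.+1) (d.+1 %/ 2) %/ 2 ^ k = logn 2 (d.+1 %/ 2)`!)%N.
  rewrite logn_fact //.
  have le : ((d.+1 %/ 2).+1 <= d.+1)%N by lia.
  rewrite [LHS](big_cat_nat (n := (d.+1 %/ 2).+1)) //=.
  rewrite [X in (_ + X)%N]big1_seq ?addn0 // => k /andP[_].
  rewrite mem_index_iota => /andP[lk _].
  by rewrite divn_small // (ltn_trans _ (ltn_expl k (isT : 1 < 2)%N)).
have := IH (d.+1 %/ 2)%N; lia.
Qed.

(* Away from 2 an odd starting point is congruent to an even one, so only the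
   2-part of d! needs the factor 2 ^ d. *)
Lemma fact_dvd_prod_step2 (d : nat) (o : int) :
  (d`!%:Z %| 2 ^+ d * \prod_(t < d) (o + 2 * t%:Z))%Z.
Proof.
have dgt0 := fact_gt0 d.
pose h := (d`!`_2^')%N; have hodd : odd h.
  by rewrite -coprime2n (@pnat_coprime 2%N) ?part_pnat ?pnat_id.
rewrite -(partnC 2%N dgt0) PoszM dvdz_mul //.
  by rewrite p_part dvdzE abszX dvdn_exp2l // logn2_fact_le.
have [c Ec] : exists c : int, o + o * h%:Z = 2 * c.
  exists ((o * (1 + h%:Z)) %/ 2)%Z.
  rewrite [RHS]mulrC divzK; first by ring.
  by rewrite dvdz_mull // dvdzE /=; lia.
apply: (@dvdz_shift_prod _ _ o); rewrite -/h Ec prod_step2_even.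
apply: dvdz_mull; apply: dvdz_trans (fact_dvd_prod_consecutive d c).
by rewrite dvdzE /= dvdn_part.
Qed.

(** * Pade approximations to sqrt(1 - z), in the variable x with x^2 = 1 - z *)

Definition theta_step (R : comNzRingType) (c : R) (f : {poly R}) : {poly R} :=
  c *: f - 'X * f^`().

Lemma coef_theta_step (R : comNzRingType) (c : R) (f : {poly R}) (e : nat) :
  (theta_step c f)`_e = (c - e%:R) * f`_e.
Proof.
rewrite /theta_step coefB coefZ coefXM; case: e => [|e] /=.
  by rewrite mulr0n !subr0.
by rewrite coef_deriv mulrBl mulr_natl.
Qed.

Lemma theta_step_sum (R : comNzRingType) (c : R) (n : nat)
    (F : 'I_n -> {poly R}) :
  theta_step c (\sum_(p < n) F p) = \sum_(p < n) theta_step c (F p).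
Proof.
by rewrite /theta_step sumrB -scaler_sumr -mulr_sumr (raddf_sum (@deriv R)).
Qed.

Lemma theta_stepZ (R : comNzRingType) (c a : R) (f : {poly R}) :
  theta_step c (a *: f) = a *: theta_step c f.
Proof. by rewrite /theta_step derivZ scalerBr -scalerAr !scalerA mulrC. Qed.

Lemma theta_step_bernstein (R : comNzRingType) (c : R) (p q : nat) :
  theta_step c ('X^p * (1 - 'X) ^+ q) =
  (c - p%:R) *: ('X^p * (1 - 'X) ^+ q) +
  q%:R *: ('X^(p.+1) * (1 - 'X) ^+ q.-1).
Proof.
have -> : 'X^(p.+1) * (1 - 'X) ^+ q.-1 = 'X * ('X^p * (1 - 'X) ^+ q.-1) :> {poly R}.
  by rewrite exprS mulrA.
rewrite /theta_step derivM derivXn deriv_exp derivB derivX derivC sub0r.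
rewrite mulrDr !mulN1r mulNrn.
have -> : 'X * ('X^(p.-1) *+ p * (1 - 'X) ^+ q) = p%:R *: ('X^p * (1 - 'X) ^+ q) :> {poly R}.
  rewrite scaler_nat -mulrnAl mulrA; congr (_ * _).
  by case: p => [|p]; rewrite ?mulr0n ?mulr0 // mulrnAr -exprS.
by rewrite scalerBl !scaler_nat !mulrN !mulrnAr opprD opprK addrA.
Qed.

(* The numerators of the Pade approximations: vanishing of the factor 2i - e at
   the even exponents e = 2i with b < i <= b + D lowers the degree of the even
   part, while each theta_step lowers the order of vanishing at 1 only by one. *)
Definition theta_binomial (R : comNzRingType) (M b D : nat) : {poly R} :=
  \poly_(e < M.+1) ((-1) ^+ e * 'C(M, e)%:R *
                    \prod_(t < D) ((2 * (b + t.+1))%:R - e%:R)).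

Lemma theta_binomial0 (R : comNzRingType) (M b : nat) :
  theta_binomial R M b 0 = (1 - 'X) ^+ M.
Proof.
rewrite /theta_binomial poly_def exprBn; apply: eq_bigr => e _.
rewrite big_ord0 mulr1 expr1n mulr1 mulr_natr -scalerMnl.
by rewrite -mul_polyC rmorphXn /= rmorphN rmorph1.
Qed.

Lemma theta_binomialS (R : comNzRingType) (M b D : nat) :
  theta_binomial R M b D.+1 =
  theta_step (2 * (b + D.+1))%:R (theta_binomial R M b D).
Proof.
apply/polyP=> e; rewrite coef_theta_step !coef_poly.
by case: ifP => _; rewrite ?mulr0 // big_ord_recr /= mulrA mulrC.
Qed.

(** In the polynomials [B p], each [theta_step] keeps the coefficients nonnegative, since c >= p for
    the indices that occur. The last term, p = D, alone gives the lower bound. For the upper bound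
    each step costs at most a factor M / (1 - x), because c <= M by the hypothesis on M. *)
Lemma theta_binomial_bounds (R : realFieldType) (M b D : nat) (x : R) :
  0 < x -> x < 1 -> (2 * (b + D) <= M)%N ->
  (M ^_ D)%:R * x ^+ D * (1 - x) ^+ (M - D) <= (theta_binomial R M b D).[x] /\
  (theta_binomial R M b D).[x] * (1 - x) ^+ D <= M%:R ^+ D * (1 - x) ^+ M.
Proof.
move=> x0 x1; pose B p : {poly R} := 'X^p * (1 - 'X) ^+ (M - p).
have Bx p : (B p).[x] = x ^+ p * (1 - x) ^+ (M - p).
  by rewrite /B !hornerE.
have B0 p : 0 <= (B p).[x].
  by rewrite Bx mulr_ge0 ?exprn_ge0 ?subr_ge0 // ltW.
suff: (2 * (b + D) <= M)%N -> exists h : nat -> R,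
    [/\ forall p, 0 <= h p, h D = (M ^_ D)%:R,
       theta_binomial R M b D = \sum_(p < D.+1) h p *: B p &
       (theta_binomial R M b D).[x] * (1 - x) ^+ D <= M%:R ^+ D * (1 - x) ^+ M].
  move=> + leD => /(_ leD)[h [h0 hD Eh ub]]; split=> //.
  rewrite Eh horner_sum big_ord_recr /= hornerZ Bx hD mulrA lerDr.
  by apply: sumr_ge0 => p _; rewrite hornerZ mulr_ge0.
elim: D => [|D IH] leD.
  exists (fun=> 1); rewrite theta_binomial0; split=> //.
    by rewrite big_ord1 scale1r /B expr0 mul1r subn0.
  by rewrite !expr0 mulr1 mul1r !hornerE.
have {IH} [|h [h0 hD Eh ub]] := IH; first by lia.
pose c : R := (2 * (b + D.+1))%:R.
have c_ge p : (p <= D)%N -> 0 <= c - p%:R by move=> le; rewrite subr_ge0 ler_nat; lia.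
have stepB p : (p <= D)%N ->
    theta_step c (B p) = (c - p%:R) *: B p + (M - p)%:R *: B p.+1.
  by move=> _; rewrite theta_step_bernstein /B subnS.
exists (fun p => (if (p <= D)%N then (c - p%:R) * h p else 0) +
   (if p is p'.+1 then (M - p')%:R * h p' else 0)); split.
- move=> p; rewrite addr_ge0 //; first by case: ifP => // /c_ge ?; rewrite mulr_ge0.
  by case: p => // p; rewrite mulr_ge0.
- by rewrite ltnn add0r hD ffactnSr natrM mulrC.
- rewrite theta_binomialS Eh theta_step_sum.
  under eq_bigr => p _ do rewrite theta_stepZ stepB -1?ltnS // scalerDr !scalerA.
  rewrite big_split /=.
  under [RHS]eq_bigr do rewrite scalerDl.
  rewrite [RHS]big_split /=; congr (_ + _).
    rewrite [RHS]big_ord_recr /= ltnn scale0r addr0.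
    by apply: eq_bigr => p _; rewrite -ltnS ltn_ord mulrC.
  rewrite [RHS]big_ord_recl /= scale0r add0r.
  by apply: eq_bigr => p _; rewrite /bump /= add1n mulrC.
have step p : (p <= D)%N ->
    (theta_step c (B p)).[x] * (1 - x) <= M%:R * (B p).[x].
  move=> le; rewrite stepB // !hornerD !hornerZ mulrDl -!mulrA.
  have -> : (B p.+1).[x] * (1 - x) = x * (B p).[x].
    rewrite !Bx exprS -!mulrA -exprSr; congr (_ * (_ * _ ^+ _)).
    by clear -le leD; lia.
  have -> : (c - p%:R) * ((B p).[x] * (1 - x)) + (M - p)%:R * (x * (B p).[x]) =
    ((c - p%:R) * (1 - x) + (M - p)%:R * x) * (B p).[x] by ring.
  apply: ler_wpM2r => //.
  have cM : c - p%:R <= M%:R.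
    by rewrite lerBlDr -natrD ler_nat; lia.
  have dM : (M - p)%:R <= M%:R :> R by rewrite ler_nat leq_subr.
  by nra.
rewrite theta_binomialS Eh theta_step_sum horner_sum exprSr mulrCA mulrA.
rewrite [M%:R ^+ _]exprS -[leRHS]mulrA.
apply: (@le_trans _ _ (M%:R * ((theta_binomial R M b D).[x] * (1 - x) ^+ D))); last first.
  by rewrite ler_wpM2l.
rewrite [_ * (\sum_i _)]mulrC mulrAC [leRHS]mulrA.
apply: ler_wpM2r; first by rewrite exprn_ge0 // subr_ge0 ltW.
rewrite Eh horner_sum mulr_sumr mulr_suml; apply: ler_sum => p _.
rewrite theta_stepZ !hornerZ -!mulrA [leRHS]mulrCA ler_wpM2l //.
by rewrite step // -ltnS.
Qed.

Lemma sum_even_odd (V : nmodType) (n : nat) (F : nat -> V) :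
  \sum_(e < n.*2) F e = \sum_(i < n) (F i.*2 + F i.*2.+1).
Proof.
elim: n => [|n IH]; first by rewrite !big_ord0.
by rewrite doubleS !big_ord_recr /= IH addrA.
Qed.

(** The division is exact. The factors of the product are odd, so the power 2^d has to supply the
    2-part of d!. *)
Definition pade_odd_factor (b d j : nat) : int :=
  ((2 ^+ d * \prod_(t < d) ((2 * (b + t.+1))%N%:Z - j.*2.+1%:Z)) %/ d`!%:Z)%Z.

Lemma pade_odd_factorE (b d j : nat) :
  2 ^+ d * \prod_(t < d) ((2 * (b + t.+1))%N%:Z - j.*2.+1%:Z) =
  d`!%:Z * pade_odd_factor b d j.
Proof.
rewrite [RHS]mulrC divzK //.
have := fact_dvd_prod_step2 d ((2 * b.+1)%N%:Z - j.*2.+1%:Z).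
congr (_ %| _ * _)%Z; apply: eq_bigr => t _; lia.
Qed.

Lemma pade_even_factorE (b d i : nat) : (i <= b + d)%N ->
  \prod_(t < d) ((2 * (b + t.+1))%N%:Z - i.*2%:Z) =
  2 ^+ d * (d`! * 'C(b + d - i, d))%N%:Z.
Proof.
move=> le; have [lt_bi|le_ib] := ltnP b i.
  rewrite bin_small ?muln0 ?mulr0; last by lia.
  have lt : (i - b.+1 < d)%N by lia.
  by rewrite (bigD1 (Ordinal lt)) //= (_ : _ - _ = 0) ?mul0r //; lia.
rewrite mulnC bin_ffact ffact_prod (big_morph Posz PoszM (erefl _)).
rewrite -[X in 2 ^+ X]card_ord -prodr_const -big_split /=.
rewrite [RHS](reindex_inj rev_ord_inj) /=.
by apply: eq_bigr => t _; have := ltn_ord t; lia.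
Qed.

(** The second binomial vanishes for b < i <= b + d, so the even part has degree b in x^2, against b
    + d for the odd part. *)
Definition pade_even (b d i : nat) : nat :=
  'C((b + d).*2.+1, i.*2) * 'C(b + d - i, d).

Definition pade_odd (b d j : nat) : int :=
  'C((b + d).*2.+1, j.*2.+1)%:Z * pade_odd_factor b d j.

(** Splitting into even and odd exponents gives integral polynomials P, Q in x^2, of degrees at most
    b and b + d, with 4^d P - x Q vanishing at x = 1 to order 2 b + d + 1. This is the order of a
    Pade approximant to x = sqrt(1 - z). *)
Lemma pade_identity (R : comNzRingType) (b d : nat) (x : R) :
  2 ^+ d * (theta_binomial R (b + d).*2.+1 b d).[x] =
  d`!%:R * (4 ^+ d * (\sum_(i < (b + d).+1) (pade_even b d i)%:R * x ^+ i.*2) -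
            x * (\sum_(j < (b + d).+1) (pade_odd b d j)%:~R * x ^+ j.*2)).
Proof.
rewrite horner_poly -[(_.*2.+1).+1]/((b + d).+1.*2)%N.
pose c (e : nat) : int := \prod_(t < d) ((2 * (b + t.+1))%N%:Z - e%:Z).
have cE (e : nat) : \prod_(t < d) ((2 * (b + t.+1))%:R - e%:R) = (c e)%:~R :> R.
  by rewrite rmorph_prod; apply: eq_bigr => t _; rewrite rmorphB.
under eq_bigr do rewrite cE.
rewrite (sum_even_odd _ (fun e => (-1) ^+ e * 'C((b + d).*2.+1, e)%:R * (c e)%:~R * x ^+ e)).
rewrite [X in _ - X]mulr_sumr [X in X - _]mulr_sumr -sumrB !mulr_sumr.
apply: eq_bigr => i _; rewrite /pade_even /pade_odd.
rewrite /c pade_even_factorE -1?ltnS // -signr_odd odd_double expr0.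
rewrite -[(-1) ^+ i.*2.+1]signr_odd /= odd_double expr1 mul1r.
have E : 2 ^+ d * (c i.*2.+1)%:~R = d`!%:R * (pade_odd_factor b d i)%:~R :> R.
  have := congr1 (fun z : int => z%:~R : R) (pade_odd_factorE b d i).
  by rewrite !rmorphM rmorphXn.
rewrite mulrDr -/(c _) !(rmorphM intr) (rmorphXn intr) /= natrM -pmulrn natrM exprS.
have -> : 4 ^+ d = 2 ^+ d * 2 ^+ d :> R by rewrite -exprMn -natrM.
transitivity (d`!%:R * (2 ^+ d * 2 ^+ d * ('C((b + d).*2.+1, i.*2)%:R * 'C(b + d - i, d)%:R * x ^+ i.*2)) -
   'C((b + d).*2.+1, i.*2.+1)%:R * (x * x ^+ i.*2) * (2 ^+ d * (c i.*2.+1)%:~R)).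
  ring.
rewrite E; ring.
Qed.

(** A single term of (1 + 3)^n gives 3^d 'C(n, d) <= 4^n. With n = b + d - i this bounds the sum by
    the even-index terms of (2 + 1)^M, where M = 2 (b + d) + 1. *)
Lemma sum_pade_even_le (b d : nat) :
  (3 ^ d * \sum_(i < (b + d).+1) pade_even b d i <= 3 ^ (b + d).*2.+1)%N.
Proof.
have bin3 n : (3 ^ d * 'C(n, d) <= 4 ^ n)%N.
  have [lt|le] := ltnP n d; first by rewrite bin_small ?muln0.
  rewrite -[4%N]/(1 + 3)%N expnDn (bigD1 (Ordinal (le : d < n.+1)%N)) //=.
  by rewrite exp1n mul1n mulnC leq_addr.
rewrite -[X in (_ <= X ^ _)%N]/(2 + 1)%N expnDn -[(_.*2.+1).+1]/((b + d).+1.*2)%N.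
rewrite (sum_even_odd _ (fun e => 'C((b + d).*2.+1, e) * (2 ^ ((b + d).*2.+1 - e) * 1 ^ e))%N).
rewrite big_distrr /=; apply: leq_sum => i _.
apply: leq_trans (leq_addr _ _); rewrite /pade_even mulnCA leq_mul2l; apply/orP; right.
rewrite exp1n muln1 (leq_trans (bin3 _)) // -[4%N]/(2 ^ 2)%N -expnM leq_exp2l //.
by have := ltn_ord i; lia.
Qed.

Lemma exp3_le_bin (M d : nat) : (3 * d <= M)%N -> (3 ^ d <= 'C(M, d))%N.
Proof.
move=> le; rewrite -(leq_pmul2r (fact_gt0 d)) bin_ffact ffact_prod fact_prod.
rewrite big_add1 big_mkord -[X in (_ ^ X * _)%N]card_ord -prod_nat_const -big_split /=.
rewrite (reindex_inj rev_ord_inj) /=; apply: leq_prod => i _.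
by have := ltn_ord i; lia.
Qed.

Lemma exp_le_ffact (M d : nat) : (M ^ d <= (M + d).-1 ^_ d)%N.
Proof.
rewrite ffact_prod -[X in (_ ^ X <= _)%N]card_ord -prod_nat_const.
by apply: leq_prod => i _; have := ltn_ord i; lia.
Qed.

Lemma bin_exp_le (n k c : nat) : (k <= n)%N -> ('C(n, k) * c ^ (n - k) <= c.+1 ^ n)%N.
Proof.
move=> le; rewrite -addn1 expnDn (bigD1 (Ordinal (le : (k < n.+1)%N))) //=.
by rewrite exp1n muln1 leq_addr.
Qed.

(** * Numerical estimates for b = 3 s, d = 5 s, and the gap below odd powers of 2 *)

(** With u = 1 - l this makes A, multiplied by the common denominator q 2^(7 + r + 120 s), less than
    1. The constant 2^92 stands for q 2^(7 + r), where q = sqrt 2 < 2 and r <= 84. *)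
Lemma pade_numerator_small (R : realFieldType) (s : nat) (u : R) :
  (31 <= s)%N -> 0 <= u -> u * 96 ^+ 2 <= 1 ->
  2 ^+ 92 * 2 ^+ (120 * s) * (2 ^+ (5 * s) *
    'C(21 * s, 5 * s)%:R * u ^+ (11 * s).+1) < 1.
Proof.
move=> s31 u0 u1; have pos (c j : nat) : 0 <= c%:R ^+ j :> R by rewrite exprn_ge0.
have bin_le : 'C(21 * s, 5 * s)%:R * 4 ^+ (16 * s) <= 5 ^+ (21 * s) :> R.
  rewrite -!natrX -natrM ler_nat.
  have := @bin_exp_le (21 * s) (5 * s) 4.
  by rewrite -mulnBl; apply; rewrite leq_mul2r orbT.
have pw (c : R) j : c ^+ (j * s) = (c ^+ j) ^+ s by rewrite exprM.
set B : R := 96 ^+ 2 in u1.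
have B1 : 1 < B by rewrite /B; lra.
have B0 : 0 <= B by apply: ltW; apply: lt_trans B1.
(* Each unit of s leaves a spare factor 8; for s >= 31 these factors absorb 2^92. *)
have base : (2 ^+ 3) ^+ s * (2 ^+ (120 * s) * 2 ^+ (5 * s) * 5 ^+ (21 * s))
     <= B ^+ (11 * s) * 4 ^+ (16 * s).
  rewrite !pw -!exprMn; apply: lerXn2r; rewrite ?nnegrE.
  - by rewrite !mulr_ge0 // pos.
  - by rewrite mulr_ge0 ?pos ?exprn_ge0.
  - by rewrite /B; lra.
have e3 : 2 ^+ 92 <= (2 ^+ 3) ^+ s :> R.
  have le : (92 <= 3 * s)%N by lia.
  by rewrite -exprM; apply: (ler_weXn2l _ le); rewrite ler1n.
move: B B0 B1 u1 base => B B0 B1 u1 base.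
have u_le : u ^+ (11 * s).+1 * B ^+ (11 * s).+1 <= 1.
  by rewrite -exprMn exprn_ile1 ?mulr_ge0.
have num : 2 ^+ 92 * (2 ^+ (120 * s) * 2 ^+ (5 * s) * 5 ^+ (21 * s)) <
    B ^+ (11 * s).+1 * 4 ^+ (16 * s).
  apply: (@le_lt_trans _ _ (B ^+ (11 * s) * 4 ^+ (16 * s))); last first.
    by rewrite ltr_pM2r ?exprn_gt0 // exprSr ltr_pMr // exprn_gt0 // (lt_trans _ B1).
  apply: le_trans base; apply: (ler_wpM2r _ e3).
  by rewrite !mulr_ge0 // pos.
have p : 0 < B ^+ (11 * s).+1 * 4 ^+ (16 * s) :> R.
  by rewrite mulr_gt0 ?exprn_gt0 // (lt_trans _ B1).
rewrite -(ltr_pM2r p) mul1r; apply: le_lt_trans num.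
move: (2 ^+ 92) e3 (pos 2 92%N) (pos 2 (120 * s)%N) (pos 2 (5 * s)%N) => c1 _.
move: (2 ^+ (120 * s)) (2 ^+ (5 * s)) (4 ^+ (16 * s)) bin_le p (pos 4 (16 * s)%N) => c2 c3 c4.
move=> bin_le p c40 c10 c20 c30.
have -> : c1 * c2 * (c3 * 'C(21 * s, 5 * s)%:R * u ^+ (11 * s).+1) *
  (B ^+ (11 * s).+1 * c4) = c1 * ((c2 * c3) *
  (u ^+ (11 * s).+1 * B ^+ (11 * s).+1 * ('C(21 * s, 5 * s)%:R * c4))) by ring.
rewrite ler_wpM2l // ler_wpM2l ?mulr_ge0 // -[leRHS]mul1r.
by apply: ler_pM => //; rewrite ?mulr_ge0 ?exprn_ge0.
Qed.

(** Compares the error 4^d (1 - l') P, where 1 - l' <= 2^-(166 s + 14), with the lower bound 5^d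
    u^(11 s + 1) for A, where u = 1 - l. *)
Lemma pade_numerator_large (R : realFieldType) (s : nat) (u : R) :
  (1 <= s)%N -> 1 <= u * 97 ^+ 2 ->
  4 ^+ (5 * s) * 3 ^+ (11 * s).+1 <
  5 ^+ (5 * s) * u ^+ (11 * s).+1 * 2 ^+ (166 * s + 14).
Proof.
move=> s1 u1.
have pw (c : R) j : c ^+ (j * s) = (c ^+ j) ^+ s by rewrite exprM.
have pos (c j : nat) : 0 <= c%:R ^+ j :> R by rewrite exprn_ge0.
set B : R := 97 ^+ 2 in u1.
have B0 : 0 < B by rewrite exprn_gt0.
have base : 2 ^+ s * (4 ^+ (5 * s) * 3 ^+ (11 * s) * B ^+ (11 * s)) <=
      5 ^+ (5 * s) * 2 ^+ (166 * s) :> R.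
  rewrite !pw -!exprMn; apply: lerXn2r; rewrite ?nnegrE.
  - by rewrite !mulr_ge0 ?pos // exprn_ge0 // ltW.
  - by rewrite mulr_ge0 ?pos.
  - by rewrite /B; lra.
have c14 : 3 * B < 2 * 2 ^+ 14 by rewrite /B; lra.
have e1 : 2 <= 2 ^+ s :> R.
  by rewrite -[leLHS]expr1; apply: (ler_weXn2l _ s1); rewrite ler1n.
move: B B0 u1 base c14 => B B0 u1 base c14.
have u_ge : 1 <= u ^+ (11 * s).+1 * B ^+ (11 * s).+1.
  by rewrite -exprMn exprn_ege1.
have p : 0 < B ^+ (11 * s).+1 :> R by rewrite exprn_gt0.
have num : 4 ^+ (5 * s) * 3 ^+ (11 * s).+1 * B ^+ (11 * s).+1 <
    5 ^+ (5 * s) * 2 ^+ (166 * s + 14) :> R.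
  rewrite !exprSr exprD.
  set z := 4 ^+ _ * 3 ^+ _ * B ^+ _ in base.
  have z0 : 0 < z by rewrite !mulr_gt0 ?exprn_gt0.
  have -> : 4 ^+ (5 * s) * (3 ^+ (11 * s) * 3) * (B ^+ (11 * s) * B) = 3 * B * z.
    by rewrite /z; ring.
  have q14 : 0 < 2 ^+ 14 :> R by rewrite exprn_gt0.
  rewrite mulrA; apply: (@lt_le_trans _ _ (2 ^+ s * z * 2 ^+ 14)); last first.
    by rewrite ler_pM2r.
  move: (2 ^+ 14) (2 ^+ s) q14 e1 c14 => c y q14 e1 c14.
  rewrite [ltRHS]mulrAC ltr_pM2r //; apply: (lt_le_trans c14).
  by rewrite ler_pM2r.
rewrite -(ltr_pM2r p); apply: (lt_le_trans num).
move: (2 ^+ _) (pos 2 (166 * s + 14)%N) (5 ^+ _) (pos 5 (5 * s)%N) => c c0 c' c'0.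
have -> : c' * u ^+ (11 * s).+1 * c * B ^+ (11 * s).+1 =
  (c' * c) * (u ^+ (11 * s).+1 * B ^+ (11 * s).+1) by ring.
by rewrite ler_peMr // mulr_ge0.
Qed.

Lemma pade_even_eq0 (b d i : nat) : (b < i <= b + d)%N -> pade_even b d i = 0%N.
Proof. by move=> ?; rewrite /pade_even (@bin_small (b + d - i)) ?muln0 //; lia. Qed.

(* With b = 3s and d = 5s, the Pade approximation at 181 / (2^7 sqrt 2) and the
   approximation x / (2^k sqrt 2) of 1 combine into an integer [I]. The form A
   dominates the error caused by x, so I > 0, and A is too small for I >= 1. *)
Lemma gap_odd_large (R : rcfType) (s r k x : nat) :
  (31 <= s)%N -> (r < 85)%N -> (k = 7 + 85 * s + r)%N ->
  (x ^ 2 < 2 ^ k.*2.+1)%N -> (2 ^ k.*2.+1 <= (2 ^ k.*2.+1 - x ^ 2) ^ 50)%N.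
Proof.
move=> s31 r85 Ek.
pose b := (3 * s)%N; pose d := (5 * s)%N.
have Ebd : (b + d = 8 * s)%N by rewrite /b /d; lia.
have leM : (2 * (b + d) <= (b + d).*2.+1)%N by lia.
have Md : ((b + d).*2.+1 - d = (11 * s).+1)%N by rewrite /b /d; lia.
have Md' : ((b + d).*2.+1 = (11 * s).+1 + d)%N by rewrite /b /d; lia.
have Md'' : (((b + d).*2.+1 + d).-1 = 21 * s)%N by rewrite /b /d; lia.
have le3d : (3 * d <= (b + d).*2.+1)%N by rewrite /b /d; lia.
(* Here 2k + 1 = 170 s + 15 + 2 r, and 49/50 of it is at least 166 s + 14: this is the precision
   gained from assuming the gap smaller than 2^((2k+1)/50). *)
have le_y : (k.*2.+1 + (166 * s + 14) * 50 <= k.*2.+1 * 50)%N by lia.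
have le_r : (7 + r <= 91)%N by lia.
have s1 : (1 <= s)%N by lia.
move=> xlt; rewrite leqNgt; apply/negP=> small.
pose q : R := Num.sqrt 2.
have q2 : q * q = 2 by rewrite -expr2 sqr_sqrtr.
have q0 : 0 < q by rewrite sqrtr_gt0.
have q_lt2 : q < 2 by nra.
have qN0 : q != 0 by rewrite gt_eqF.
pose l : R := 181 / (128 * q); pose l' : R := x%:R / (2 ^+ k * q).
have l0 : 0 < l by rewrite divr_gt0 ?mulr_gt0.
have lE : 128 * q * l = 181 by rewrite /l; field.
(* 181^2 = 2^15 - 7, so l is very close to 1. *)
have l2 : l * l * 2 ^+ 15 = 181 ^+ 2 by have : q * q * (l * l) * 128 ^+ 2 = 181 ^+ 2; [rewrite -lE; ring | rewrite q2; lra].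
have l_lt1 : l < 1 by nra.
(* As 1 - l^2 = 7 / 2^15, the number 1 - l is about 1/9362, between 97^-2 and 96^-2. *)
have u_up : (1 - l) * 96 ^+ 2 <= 1 by nra.
have l_ge : 5 <= 2 * 3 * l by lra.
have u_lo : 1 <= (1 - l) * 97 ^+ 2 by nra.
have k20 : 0 < 2 ^+ k :> R by rewrite exprn_gt0.
have l'E : q * 2 ^+ k * l' = x%:R by rewrite /l'; field; rewrite qN0 gt_eqF.
have l'0 : 0 <= l' by rewrite divr_ge0 // mulr_ge0 // ltW.
pose y := (2 ^ k.*2.+1 - x ^ 2)%N.
have l'2 : (1 - l' * l') * 2 ^+ k.*2.+1 = y%:R.
  rewrite /y natrB ?(ltnW xlt) // !natrX mulrBl mul1r; congr (_ - _).
  rewrite -l'E exprS -addnn exprD -q2; ring.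
have l'_lt1 : l' < 1.
  have : 0 < (1 - l' * l') * 2 ^+ k.*2.+1 by rewrite l'2 ltr0n subn_gt0.
  by rewrite pmulr_lgt0 ?exprn_gt0 // => ?; nra.
have y_small : (y * 2 ^ (166 * s + 14) <= 2 ^ k.*2.+1)%N.
  rewrite -(@leq_exp2r _ _ 50) // expnMn -!expnM.
  apply: leq_trans (_ : 2 ^ k.*2.+1 * 2 ^ ((166 * s + 14) * 50) <= _)%N.
    by rewrite leq_mul2r ltnW ?orbT.
  by rewrite -expnD; exact: (leq_pexp2l (isT : 0 < 2)%N le_y).
have l'_near : (1 - l') * 2 ^+ (166 * s + 14) <= 1.
  have p : 0 < 2 ^+ k.*2.+1 :> R by rewrite exprn_gt0.
  have c0 : 0 <= 2 ^+ (166 * s + 14) :> R by rewrite exprn_ge0.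
  have : (1 - l') * 2 ^+ (166 * s + 14) <= (1 - l' * l') * 2 ^+ (166 * s + 14).
    by apply: ler_wpM2r => //; nra.
  move/le_trans; apply; rewrite -(ler_pM2r p) mul1r mulrAC l'2.
  by rewrite -!natrX -natrM ler_nat.
pose F := theta_binomial R (b + d).*2.+1 b d.
pose A := 2 ^+ d * F.[l] / d`!%:R.
pose P := \sum_(i < (b + d).+1) (pade_even b d i)%:R * l ^+ i.*2.
pose Q := \sum_(j < (b + d).+1) (pade_odd b d j)%:~R * l ^+ j.*2.
have dN0 : d`!%:R != 0 :> R by rewrite pnatr_eq0 -lt0n fact_gt0.
have AE : A = 4 ^+ d * P - l * Q.
  by rewrite /A /F pade_identity mulrC mulKf.
have P0 : 0 <= P by apply: sumr_ge0 => i _; rewrite mulr_ge0 ?exprn_ge0 // ltW.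
have P_le : P <= 3 ^+ (11 * s).+1.
  apply: (@le_trans _ _ (\sum_(i < (b + d).+1) pade_even b d i)%:R).
    rewrite natr_sum; apply: ler_sum => i _.
    by rewrite ler_piMr // exprn_ile1 // ltW.
  rewrite -natrX ler_nat -(leq_pmul2l (expn_gt0 3 d : (0 < 3 ^ d)%N)) -expnD.
  apply: leq_trans (sum_pade_even_le b d) _.
  by rewrite Md' addnC.
have [Flo Fup] : ((b + d).*2.+1 ^_ d)%:R * l ^+ d * (1 - l) ^+ ((b + d).*2.+1 - d) <= F.[l] /\
  F.[l] * (1 - l) ^+ d <= (b + d).*2.+1%:R ^+ d * (1 - l) ^+ (b + d).*2.+1.
  by apply: theta_binomial_bounds => //; rewrite -muln2; lia.
have u0 : 0 < 1 - l by rewrite subr_gt0.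
have A_lo : 5 ^+ d * (1 - l) ^+ (11 * s).+1 <= A.
  rewrite /A ler_pdivlMr ?ltr0n ?fact_gt0 //.
  apply: le_trans (ler_wpM2l (exprn_ge0 d (ler0n _ 2)) Flo).
  rewrite Md -bin_ffact natrM.
  have : 5 ^+ d <= 2 ^+ d * 'C((b + d).*2.+1, d)%:R * l ^+ d.
    apply: (@le_trans _ _ (2 ^+ d * 3 ^+ d * l ^+ d)).
      rewrite -!exprMn; apply: lerXn2r; rewrite ?nnegrE; last exact: l_ge.
        exact: ler0n.
      exact: (le_trans (ler0n R 5) l_ge).
    rewrite ler_wpM2r ?exprn_ge0 ?(ltW l0) // ler_wpM2l ?exprn_ge0 //.
    by rewrite -natrX ler_nat exp3_le_bin.
  have z0 : 0 <= (1 - l) ^+ (11 * s).+1 * d`!%:R by rewrite mulr_ge0 ?exprn_ge0 // ltW.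
  move/(ler_wpM2r z0); rewrite mulrA => /le_trans; apply.
  by rewrite le_eqVlt; apply/orP; left; apply/eqP; ring.
have A_up : A <= 2 ^+ d * 'C(21 * s, d)%:R * (1 - l) ^+ (11 * s).+1.
  rewrite /A ler_pdivrMr ?ltr0n ?fact_gt0 // -!mulrA ler_wpM2l ?exprn_ge0 //.
  have z0 : 0 < (1 - l) ^+ d by rewrite exprn_gt0.
  rewrite -(ler_pM2r z0); apply: (le_trans Fup).
  rewrite [leRHS]mulrC mulrCA mulrA [_ * d`!%:R]mulrC -!mulrA.
  have -> : (1 - l) ^+ (b + d).*2.+1 = (1 - l) ^+ (11 * s).+1 * (1 - l) ^+ d.
    by rewrite Md' exprD.
  have : (b + d).*2.+1%:R ^+ d <= 'C(21 * s, d)%:R * d`!%:R :> R.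
    by rewrite -natrX -natrM ler_nat bin_ffact -Md'' exp_le_ffact.
  have z1 : 0 <= (1 - l) ^+ (11 * s).+1 * (1 - l) ^+ d.
    by rewrite mulr_ge0 // exprn_ge0 // ltW.
  move/(ler_wpM2r z1)/le_trans; apply.
  by rewrite le_eqVlt; apply/orP; left; apply/eqP; ring.
have W_lt : 4 ^+ d * (1 - l') * P < A.
  apply: lt_le_trans A_lo.
  have p : 0 < 2 ^+ (166 * s + 14) :> R by rewrite exprn_gt0.
  rewrite -(ltr_pM2r p).
  apply: le_lt_trans (pade_numerator_large s1 u_lo).
  rewrite -!mulrA ler_wpM2l ?exprn_ge0 // mulrCA.
  by apply: le_trans P_le; rewrite ler_piMr.
have scale n i : (i <= n)%N ->
    181 ^+ i.*2 * 2 ^+ (15 * (n - i)) = 2 ^+ (15 * n) * l ^+ i.*2.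
  move=> le; rewrite -mul2n exprM -l2 exprMn -expr2 [in LHS]exprM.
  rewrite -[in LHS]exprM -[in LHS]exprM -mulrA -exprM -exprD mulrC -mulnDr subnKC //.
(* The denominators come from l^2 = 181^2 / 2^15. The terms with i > b are zero, so the truncated
   subtraction b - i does no harm. *)
pose Pn := (\sum_(i < (b + d).+1) pade_even b d i * 181 ^ i.*2 * 2 ^ (15 * (b - i)))%N.
pose Qn : int := \sum_(j < (b + d).+1) pade_odd b d j * 181 ^+ j.*2 * 2 ^+ (15 * (b + d - j)).
have PnE : Pn%:R = 2 ^+ (15 * b) * P.
  rewrite natr_sum mulr_sumr; apply: eq_bigr => i _; rewrite 2!natrM !natrX.
  have [le_ib|lt_bi] := leqP i b; first by rewrite -mulrA scale // mulrCA.
  have -> : pade_even b d i = 0%N by apply: pade_even_eq0; rewrite lt_bi -ltnS /=.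
  by rewrite mulr0n !mul0r mulr0.
have QnE : Qn%:~R = 2 ^+ (15 * (b + d)) * Q.
  rewrite rmorph_sum mulr_sumr; apply: eq_bigr => j _.
  by rewrite 2!rmorphM !rmorphXn /= -mulrA scale -1?ltnS // mulrCA.
(* The scalings of P and Q differ by 2^(15 d), and 4^d contributes 2^(2 d); the powers of 2 match
   because 17 d = 85 s = k - 7 - r. This is the origin of the modulus 85. *)
pose I : int := (x * Pn)%N%:Z - (181 * 2 ^ r)%N%:Z * Qn.
have IE : I%:~R = q * 2 ^+ (7 + r + 120 * s) * (A - 4 ^+ d * (1 - l') * P).
  rewrite /I intrB intrM -!pmulrn 2!natrM natrX PnE QnE -l'E -lE AE.
  have -> : 4 ^+ d = 2 ^+ (10 * s) :> R by rewrite (natrM R 2 2) -expr2 -exprM /d mulnA.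
  have -> : 2 ^+ k = 2 ^+ 7 * 2 ^+ (85 * s) * 2 ^+ r :> R by rewrite Ek (exprD _ (7 + _)) exprD.
  have -> : 2 ^+ (15 * (b + d)) = 2 ^+ (120 * s) :> R by rewrite Ebd mulnA.
  have -> : 2 ^+ (15 * b) = 2 ^+ (45 * s) :> R by rewrite /b mulnA.
  rewrite (exprD _ (7 + r)) (exprD _ 7).
  have -> : 2 ^+ (120 * s) = 2 ^+ (45 * s) * 2 ^+ (75 * s) :> R by rewrite -exprD -mulnDl.
  have -> : 2 ^+ (85 * s) = 2 ^+ (10 * s) * 2 ^+ (75 * s) :> R by rewrite -exprD -mulnDl.
  by ring.
have c0 : 0 < q * 2 ^+ (7 + r + 120 * s) by rewrite mulr_gt0 ?exprn_gt0.
have I0 : 0 < I by rewrite -(ltr0z R) IE mulr_gt0 // subr_gt0.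
have I1 : I < 1.
  rewrite -(ltrz1 R) IE.
  apply: le_lt_trans (pade_numerator_small s31 (ltW u0) u_up).
  have A0 : 0 < A by apply: le_lt_trans W_lt; rewrite !mulr_ge0 ?exprn_ge0 // subr_ge0 ltW.
  apply: (@le_trans _ _ (q * 2 ^+ (7 + r + 120 * s) * A)).
    by rewrite ler_wpM2l ?(ltW c0) // lerBlDr lerDl !mulr_ge0 ?exprn_ge0 // subr_ge0 ltW.
  apply: ler_pM; rewrite ?(ltW c0) ?(ltW A0) //.
  rewrite exprD mulrA ler_wpM2r ?exprn_ge0 // exprS.
  apply: ler_pM; rewrite ?exprn_ge0 ?(ltW q0) ?(ltW q_lt2) //.
  by rewrite (ler_weXn2l _ le_r) ?ler1n.
by move: I0; rewrite gtz0_ge1 leNgt I1.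
Qed.

(** * Theta functions and the recurrence of tau at 2 *)

Fixpoint qbin (R : nzRingType) (q : R) (n k : nat) : R :=
  match n, k with
  | _, 0 => 1
  | 0, _.+1 => 0
  | n'.+1, k'.+1 => qbin q n' k' + q ^+ k * qbin q n' k
  end.

Definition qfact (R : nzRingType) (q : R) (n : nat) : R := \prod_(i < n) (1 - q ^+ i.+1).

Section QBinomial.
Variable R : comNzRingType.
Implicit Types q u z : R.

Lemma qbin0 q n : qbin q n 0 = 1. Proof. by case: n. Qed.

Lemma qbin_small q n k : (n < k)%N -> qbin q n k = 0.
Proof.
elim: n k => [|n IH] [|k] //= lt_nk.
by rewrite !IH ?mulr0 ?addr0 // ltnW.
Qed.

Lemma rmorph_qbin (S : nzRingType) (f : {rmorphism R -> S}) q n k :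
  f (qbin q n k) = qbin (f q) n k.
Proof.
elim: n k => [|n IH] [|k] /=; rewrite ?rmorph1 ?rmorph0 //.
by rewrite rmorphD rmorphM rmorphXn !IH.
Qed.

Lemma qfactS q n : qfact q n.+1 = qfact q n * (1 - q ^+ n.+1).
Proof. by rewrite /qfact big_ord_recr. Qed.

Lemma qbin_fact q n k : (k <= n)%N ->
  qbin q n k * qfact q k * qfact q (n - k) = qfact q n.
Proof.
elim: n k => [|n IH] [|k] //= le_kn; rewrite ?subn0 ?mul1r /qfact ?big_ord0 ?mulr1 ?mul1r //.
rewrite -!/(qfact _ _) subSS.
move: le_kn; rewrite ltnS leq_eqVlt => /orP[/eqP->|lt_kn].
  have := IH _ (leqnn n); rewrite subnn {2}/qfact big_ord0 mulr1 => E.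
  by rewrite (qbin_small q (ltnSn n)) mulr0 addr0 !qfactS [qfact q 0]big_ord0 mulr1 mulrA E.
have := IH _ lt_kn; rewrite -(subnSK lt_kn) !qfactS subnSK // => E1.
have := IH _ (ltnW lt_kn); rewrite -(subnSK lt_kn) qfactS subnSK // => E0.
have Eq : q ^+ k.+1 * q ^+ (n - k) = q ^+ n.+1 by rewrite -exprD addSn subnKC // ltnW.
transitivity ((qbin q n k * qfact q k * (qfact q (n - k.+1) * (1 - q ^+ (n - k)))) * (1 - q ^+ k.+1)
  + (qbin q n k.+1 * (qfact q k * (1 - q ^+ k.+1)) * qfact q (n - k.+1)) * (q ^+ k.+1 * (1 - q ^+ (n - k)))).
  by ring.
by rewrite E0 E1 -Eq; ring.
Qed.

Lemma qbinomial q u z n :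
  \prod_(k < n) (u + z * q ^+ k) =
  \sum_(k < n.+1) q ^+ 'C(k, 2) * qbin q n k * z ^+ k * u ^+ (n - k).
Proof.
elim: n z => [|n IH] z; first by rewrite big_ord0 big_ord1 /= !expr0 !mulr1.
rewrite big_ord_recl /= expr0 mulr1.
under eq_bigr => k _ do rewrite /bump /= add1n exprS mulrA.
rewrite IH mulrDl [RHS]big_ord_recl /= !expr0 !mulr1 mul1r subn0.
rewrite !mulr_sumr.
rewrite big_ord_recl /= !expr0 qbin0 !mulr1 mul1r subn0 -exprS -addrA; congr (_ + _).
rewrite [X in X + _](_ : _ = \sum_(k < n.+1) q ^+ 'C(k.+1, 2) * (q ^+ k.+1 * qbin q n k.+1) * z ^+ k.+1 * u ^+ (n - k)).
  rewrite -big_split /=; apply: eq_bigr => k _; rewrite /bump /= add1n subSS.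
  by rewrite binS bin1 exprD exprMn !exprS add0n; ring.
rewrite [RHS]big_ord_recr /= (qbin_small _ (ltnSn n)) !(mulr0, mul0r) addr0.
apply: eq_bigr => k _; rewrite /bump /= add1n.
have -> : u ^+ (n - k) = u * u ^+ (n - k.+1) by rewrite -exprS subnSK.
by rewrite exprMn; ring.
Qed.

End QBinomial.

Lemma bin2D (m n : nat) : ('C(m + n, 2) = 'C(m, 2) + 'C(n, 2) + m * n)%N.
Proof.
elim: n => [|n IH]; first by rewrite !addn0 muln0 addn0.
by rewrite addnS !binS !bin1 IH; lia.
Qed.

Lemma bin2_double (m : nat) : (m * m = 'C(m, 2) + 'C(m, 2) + m)%N.
Proof. by elim: m => // m IH; rewrite !binS !bin1; lia. Qed.

(* Obtained from the q-binomial theorem at u = q ^ n and z = z1, cancelling a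
   monomial, whence the integral domain. *)
Lemma finite_triple_product (R : idomainType) (z1 z2 : R) (n : nat) :
  z1 != 0 -> z2 != 0 ->
  let q := z1 * z2 in
  (\prod_(i < n) (1 + z1 * q ^+ i)) * (\prod_(i < n) (1 + z2 * q ^+ i)) =
  \sum_(k < n.+1) q ^+ 'C(k, 2) * qbin q (n + n) (n + k) * z1 ^+ k +
  \sum_(k < n) q ^+ 'C(k.+1, 2) * qbin q (n + n) (n - k.+1) * z2 ^+ k.+1.
Proof.
move=> z10 z20 q; have q0 : q != 0 by rewrite mulf_neq0.
pose c := q ^+ ('C(n, 2) + n * n) * z1 ^+ n.
have c0 : c != 0 by rewrite mulf_neq0 ?expf_neq0.
apply: (mulfI c0).
transitivity (\prod_(k < n + n) (q ^+ n + z1 * q ^+ k)).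
  rewrite big_split_ord /=.
  have -> : \prod_(i < n) (q ^+ n + z1 * q ^+ (n + i)) = q ^+ (n * n) * \prod_(i < n) (1 + z1 * q ^+ i).
    have -> : q ^+ (n * n) = \prod_(i < n) q ^+ n by rewrite prodr_const card_ord exprM.
    by rewrite -big_split /=; apply: eq_bigr => i _; rewrite mulrDr mulr1 mulrCA -exprD.
  have -> : \prod_(i < n) (q ^+ n + z1 * q ^+ i) = q ^+ 'C(n, 2) * z1 ^+ n * \prod_(i < n) (1 + z2 * q ^+ i).
    have -> : z1 ^+ n = \prod_(i < n) z1 by rewrite prodr_const card_ord.
    rewrite [\prod_(i < n) (1 + _)](reindex_inj rev_ord_inj) /=.
    rewrite -bin2_sum big_mkord expr_sum -!big_split /=.
    apply: eq_bigr => i _; rewrite mulrDr mulr1 addrC; congr (_ + _); first by rewrite mulrC.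
    have -> : q ^+ n = q ^+ i * q * q ^+ (n - i.+1) by rewrite -exprSr -exprD subnKC.
    by rewrite /q; ring.
  by rewrite /c exprD; ring.
rewrite qbinomial mulrDr -addnS big_split_ord /= addrC; congr (_ + _).
  rewrite mulr_sumr; apply: eq_bigr => k _.
  rewrite /c -exprM subnDl.
  have -> : q ^+ 'C(n + k, 2) * qbin q (n + n) (n + k) * z1 ^+ (n + k) * q ^+ (n * (n - k)) =
    q ^+ ('C(n + k, 2) + n * (n - k)) * qbin q (n + n) (n + k) * (z1 ^+ n * z1 ^+ k).
    by rewrite (exprD q) (exprD z1); ring.
  have -> : ('C(n + k, 2) + n * (n - k) = 'C(n, 2) + n * n + 'C(k, 2))%N.
    have := ltn_ord k; rewrite ltnS => le; rewrite bin2D.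
    by have : (n * k <= n * n)%N; [rewrite leq_mul2l le orbT | rewrite mulnBr; lia].
  by rewrite exprD; ring.
rewrite mulr_sumr [RHS](reindex_inj rev_ord_inj) /=; apply: eq_bigr => k _.
have lt := ltn_ord k; rewrite /c subnSK // subKn; last exact: ltnW.
move: (nat_of_ord k) lt => {c c0}k lt.
have [m En] : exists m, n = (k + m)%N by exists (n - k)%N; rewrite subnKC // ltnW.
subst n; rewrite addKn (_ : k + m + (k + m) - k = k + m + m)%N; last by lia.
rewrite -exprM (exprD z1) bin2D.
have -> : q ^+ 'C(k, 2) * qbin q (k + m + (k + m)) k * z1 ^+ k * q ^+ ((k + m) * (k + m + m)) =
   q ^+ ('C(k, 2) + (k + m) * (k + m + m)) * qbin q (k + m + (k + m)) k * z1 ^+ k.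
  by rewrite exprD; ring.
have -> : ('C(k, 2) + (k + m) * (k + m + m) = 'C(k, 2) + 'C(m, 2) + k * m + (k + m) * (k + m) + 'C(m, 2) + m)%N.
  by have := bin2_double m; lia.
rewrite (exprD q (_ + 'C(m, 2))) (exprD q (_ + (k + m) * (k + m))).
by rewrite [q ^+ m]exprMn; ring.
Qed.

(** Carries the identity from an integral domain, where monomials can be cancelled, to a ring where
    the arguments are nilpotent. *)
Lemma finite_triple_product_morph (R : idomainType) (A : comNzRingType)
    (f : {rmorphism R -> A}) (z1 z2 : R) (n : nat) :
  z1 != 0 -> z2 != 0 ->
  let q := f z1 * f z2 in
  (\prod_(i < n) (1 + f z1 * q ^+ i)) * (\prod_(i < n) (1 + f z2 * q ^+ i)) =
  \sum_(k < n.+1) q ^+ 'C(k, 2) * qbin q (n + n) (n + k) * f z1 ^+ k +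
  \sum_(k < n) q ^+ 'C(k.+1, 2) * qbin q (n + n) (n - k.+1) * f z2 ^+ k.+1.
Proof.
move=> z10 z20 q; have := congr1 f (finite_triple_product n z10 z20).
rewrite rmorphM rmorphD !rmorph_prod !rmorph_sum /=.
have prodE (z : R) : \prod_(i < n) f (1 + z * (z1 * z2) ^+ i) = \prod_(i < n) (1 + f z * q ^+ i).
  by apply: eq_bigr => i _; rewrite rmorphD rmorph1 rmorphM rmorphXn rmorphM.
by rewrite !prodE => ->; congr (_ + _); apply: eq_bigr => k _;
   rewrite !rmorphM !rmorphXn rmorph_qbin rmorphM.
Qed.

(** * Infinite products at a nilpotent argument *)

Section Nilpotent.
Variable A : comNzRingType.
Implicit Types x y q z : A.

Lemma nilpotent_exp0 x (M j : nat) : x ^+ M = 0 -> (M <= j)%N -> x ^+ j = 0.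
Proof. by move=> x0 le; rewrite -(subnK le) exprD x0 mulr0. Qed.

(** If (1 - x) t = 0 then t = x t = ... = x^M t = 0. Cancellation of such factors replaces division
    by infinite products. *)
Lemma lreg_1B_nilpotent x (M : nat) : x ^+ M = 0 -> GRing.lreg (1 - x).
Proof.
move=> x0 b c /eqP; rewrite -subr_eq0 -mulrBr => /eqP; set t := b - c => E.
have tE : t = x * t by apply/eqP; rewrite -subr_eq0 -{1}[t]mul1r -mulrBl E.
have tj j : t = x ^+ j * t.
  by elim: j => [|j IH]; rewrite ?expr0 ?mul1r // exprS -mulrA -IH.
by apply/eqP; rewrite -subr_eq0 -/t (tj M) x0 mul0r.
Qed.

Lemma lreg_qfact q (M n : nat) : q ^+ M = 0 -> GRing.lreg (qfact q n).
Proof.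
move=> q0; rewrite /qfact; elim/big_ind: _ => //; first exact: lreg1.
  by move=> u v; apply: lregM.
move=> i _; apply: (@lreg_1B_nilpotent _ M).
by rewrite -exprM mulnC exprM q0 expr0n.
Qed.

Lemma qfact_stable q (M m n : nat) : q ^+ M = 0 -> (M <= m)%N -> (M <= n)%N ->
  qfact q m = qfact q n.
Proof.
move=> q0; wlog le : m n / (m <= n)%N.
  by move=> H lm ln; case/orP: (leq_total m n) => /H -> //.
move=> lm _; rewrite -(subnKC le); elim: (n - m)%N => [|j IH]; first by rewrite addn0.
by rewrite addnS qfactS -IH (nilpotent_exp0 q0) ?subr0 ?mulr1 //; lia.
Qed.

(** Once k, N - k and N all reach M, the three q-factorials in [qbin_fact] have the same stable
    value, and cancelling one of them leaves the claim. *)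
Lemma qbin_limit q (M N n k : nat) : q ^+ M = 0 ->
  (M <= k)%N -> (k + M <= N)%N -> (M <= n)%N -> qbin q N k * qfact q n = 1.
Proof.
move=> q0 lk lN ln; have le : (k <= N)%N by lia.
have lNk : (M <= N - k)%N by lia.
have lN' : (M <= N)%N by lia.
have := qbin_fact q le.
rewrite !(@qfact_stable q M _ n) // => E.
by apply: (lreg_qfact (n := n) q0); rewrite mulr1 mulrC.
Qed.

(** Jacobi's triple product. The terms of index above M vanish by hypothesis; for the others M + M
    <= n puts the Gaussian binomials in the stable range. *)
Lemma triple_product_limit (R : idomainType) (f : {rmorphism R -> A})
    (z1 z2 : R) (M n : nat) :
  z1 != 0 -> z2 != 0 -> (M + M <= n)%N ->
  let q := f z1 * f z2 in
  q ^+ M = 0 ->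
  (forall k, (M < k)%N -> q ^+ 'C(k, 2) * f z1 ^+ k = 0) ->
  (forall k, (M < k)%N -> q ^+ 'C(k, 2) * f z2 ^+ k = 0) ->
  (\prod_(i < n) (1 + f z1 * q ^+ i)) * (\prod_(i < n) (1 + f z2 * q ^+ i)) *
    qfact q n =
  \sum_(k < n.+1) q ^+ 'C(k, 2) * f z1 ^+ k +
  \sum_(k < n) q ^+ 'C(k.+1, 2) * f z2 ^+ k.+1.
Proof.
move=> z10 z20 le q q0 h1 h2; rewrite finite_triple_product_morph // -/q.
rewrite mulrDl !mulr_suml; congr (_ + _); apply: eq_bigr => k _.
  rewrite [X in X * _]mulrAC -[LHS]mulrA.
  have [lt|leM] := ltnP M k; first by rewrite h1 // !mul0r.
  by rewrite (@qbin_limit q M) ?mulr1 //; lia.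
rewrite [X in X * _]mulrAC -[LHS]mulrA.
have [lt|leM] := ltnP M k.+1; first by rewrite h2 // !mul0r.
by rewrite (@qbin_limit q M) ?mulr1 //; lia.
Qed.

End Nilpotent.

(** * Theta functions at a nilpotent argument *)

Section Theta.
Variables (A : comNzRingType) (n : nat).
Implicit Types y : A.

Definition oddprod y := \prod_(i < n) (1 - y ^+ i.*2.+1).
Definition theta3 y := \sum_(k < n.+1) y ^+ (k ^ 2) + \sum_(k < n) y ^+ (k.+1 ^ 2).
(* Twice the sum of the y ^+ (triangular number): the factor 2 is kept since A
   may have 2-torsion. *)
Definition psi2 y := \sum_(k < n.+1) y ^+ 'C(k, 2) + \sum_(k < n) y ^+ 'C(k.+2, 2).

Definition evalZ y : {rmorphism {poly int} -> A} :=
  [the {rmorphism {poly int} -> A} of horner_eval y \o map_poly intr].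

Lemma evalZX y : evalZ y 'X = y.
Proof. by rewrite /= map_polyX /horner_eval hornerX. Qed.

Variable M : nat.
Hypothesis le_Mn : (M + M <= n)%N.

(** Triple product at z1 = z2 = -X, so that q = X^2. *)
Lemma gauss_theta y : y ^+ M = 0 -> theta3 (- y) = oddprod y ^+ 2 * qfact (y ^+ 2) n.
Proof.
move=> y0; have X0 : - 'X != 0 :> {poly int} by rewrite oppr_eq0 polyX_eq0.
have fX : evalZ y (- 'X) = - y by rewrite rmorphN evalZX.
have := @triple_product_limit A _ (evalZ y) _ _ M n X0 X0 le_Mn.
cbv zeta; rewrite !fX mulrNN -expr2 => H; rewrite /theta3 /oddprod.
have qE k : (y ^+ 2) ^+ 'C(k, 2) * (- y) ^+ k = (- y) ^+ (k ^ 2).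
  rewrite -[y ^+ 2]sqrrN -exprM -exprD; congr (_ ^+ _).
  by have := bin2_double k; rewrite -mulnn; lia.
under eq_bigr do rewrite -qE.
under [X in _ + X]eq_bigr do rewrite -qE.
rewrite -H.
- rewrite -expr2; congr (_ ^+ 2 * _); apply: eq_bigr => i _.
  by rewrite mulNr -exprM -exprS mul2n.
- by rewrite -exprM mulnC exprM y0 expr0n.
- by move=> k lt; rewrite qE exprNn (nilpotent_exp0 y0) ?mulr0 //; nia.
- by move=> k lt; rewrite qE exprNn (nilpotent_exp0 y0) ?mulr0 //; nia.
Qed.

Lemma sum_shift_nilpotent (e : nat -> nat) y : y ^+ M = 0 -> e 0%N = 0%N ->
  (M <= e n)%N -> \sum_(k < n) y ^+ e k.+1 = \sum_(k < n) y ^+ e k - 1.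
Proof.
move=> y0 e0 le; apply/eqP; rewrite eq_sym subr_eq; apply/eqP.
have -> : \sum_(k < n) y ^+ e k = \sum_(k < n.+1) y ^+ e k.
  by rewrite [RHS]big_ord_recr /= (nilpotent_exp0 y0 le) addr0.
by rewrite big_ord_recl e0 expr0 addrC.
Qed.

Lemma theta3E y : y ^+ M = 0 -> theta3 y = 2 * (\sum_(k < n) y ^+ (k ^ 2)) - 1.
Proof.
move=> y0; have le : (M <= n ^ 2)%N by rewrite -mulnn; nia.
rewrite /theta3 big_ord_recr /= (nilpotent_exp0 y0 le) addr0.
by rewrite (@sum_shift_nilpotent (fun k => (k ^ 2)%N)) //; ring.
Qed.

Lemma psi2E y : y ^+ M = 0 -> psi2 y = 2 * \sum_(k < n) y ^+ 'C(k.+1, 2).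
Proof.
move=> y0; have le : (M <= 'C(n.+1, 2))%N by have := bin2_double n; rewrite binS bin1; nia.
rewrite /psi2 big_ord_recl /= expr0.
rewrite (@sum_shift_nilpotent (fun k => 'C(k.+1, 2))) //.
by under eq_bigr do rewrite /bump add1n; ring.
Qed.

(** Squares split by parity: (2i)^2 = 4 i^2 and (2i+1)^2 = 8 'C(i+1, 2) + 1. *)
Lemma theta3_even_odd y : y ^+ M = 0 ->
  theta3 y = theta3 (y ^+ 4) + y * psi2 (y ^+ 8).
Proof.
move=> y0.
have pw0 j : (y ^+ j.+1) ^+ M = 0 by rewrite -exprM mulnC exprM y0 expr0n.
rewrite !theta3E // psi2E //.
have -> : \sum_(k < n) y ^+ (k ^ 2) = \sum_(k < n.*2) y ^+ (k ^ 2).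
  rewrite -addnn big_split_ord /= [X in _ + X]big1 ?addr0 // => k _.
  by rewrite (nilpotent_exp0 y0) // -mulnn; nia.
rewrite (sum_even_odd n (fun k => y ^+ (k ^ 2))) big_split /=.
have -> : \sum_(i < n) (y ^+ 4) ^+ (i ^ 2) = \sum_(i < n) y ^+ (i.*2 ^ 2).
  by apply: eq_bigr => i _; rewrite -exprM -mul2n expnMn.
have -> : \sum_(i < n) y ^+ (i.*2.+1 ^ 2) = y * \sum_(i < n) (y ^+ 8) ^+ 'C(i.+1, 2).
  rewrite mulr_sumr; apply: eq_bigr => i _; rewrite -exprM -exprS; congr (_ ^+ _).
  by have := bin2_double i; rewrite binS bin1 -mulnn; lia.
by ring.
Qed.

(** Triple product at z1 = 1, z2 = X, combined with (1 + y^i)(1 - y^i) = 1 - y^(2i). *)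
Lemma gauss_psi y : y ^+ M = 0 -> psi2 y * qfact y n = 2 * qfact (y ^+ 2) n ^+ 2.
Proof.
move=> y0; have X0 : 'X != 0 :> {poly int} by rewrite polyX_eq0.
have n0 : y ^+ n = 0 by apply: (nilpotent_exp0 y0); lia.
have := @triple_product_limit A _ (evalZ y) 1 _ M n (oner_neq0 _) X0 le_Mn.
cbv zeta; rewrite rmorph1 !evalZX !mul1r => H.
have {H} <- : \prod_(i < n) (1 + 1 * y ^+ i) * \prod_(i < n) (1 + y * y ^+ i) * qfact y n = psi2 y.
  rewrite /psi2 H //.
  - congr (_ + _); apply: eq_bigr => k _; first by rewrite expr1n mulr1.
    by rewrite -exprD (binS k.+1) bin1.
  - move=> k lt; rewrite (nilpotent_exp0 y0) ?mul0r //.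
    by have := bin2_double k; nia.
  - move=> k lt; rewrite (nilpotent_exp0 y0) ?mul0r //.
    by have := bin2_double k; nia.
have -> : \prod_(i < n) (1 + y * y ^+ i) = \prod_(i < n) (1 + y ^+ i.+1).
  by apply: eq_bigr => i _; rewrite -exprS.
under eq_bigr do rewrite mul1r.
(* The factor at i = 0 is 2; shifting the index adds only the factor 1 + y^n = 1. *)
have -> : \prod_(i < n) (1 + y ^+ i) = 2 * \prod_(i < n) (1 + y ^+ i.+1).
  have : \prod_(i < n.+1) (1 + y ^+ i) = \prod_(i < n.+1) (1 + y ^+ i) by [].
  rewrite {1}big_ord_recr big_ord_recl /= n0 addr0 mulr1 expr0 => ->.
  by congr (_ * _).
set P := \prod_(i < n) _.
have <- : P * qfact y n = qfact (y ^+ 2) n.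
  rewrite /P /qfact -big_split /=; apply: eq_bigr => i _.
  by rewrite mulrC -exprM mulnC exprM -subr_sqr expr1n.
by ring.
Qed.

Lemma oddprod_mul y : oddprod y * oddprod (- y) = oddprod (y ^+ 2).
Proof.
rewrite /oddprod -big_split; apply: eq_bigr => i _ /=.
rewrite exprNn -signr_odd /= odd_double expr1 mulN1r opprK.
by rewrite -exprM mulnC exprM -subr_sqr expr1n.
Qed.

Lemma qfact_even_odd y : y ^+ M = 0 -> qfact y n = oddprod y * qfact (y ^+ 2) n.
Proof.
move=> y0; rewrite (@qfact_stable _ y M n n.*2) //; try lia.
rewrite /qfact /oddprod.
have prod_even_odd (F : nat -> A) m : \prod_(e < m.*2) F e = \prod_(i < m) (F i.*2 * F i.*2.+1).
  elim: m => [|m IH]; first by rewrite !big_ord0.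
  by rewrite doubleS !big_ord_recr /= IH mulrA.
rewrite (prod_even_odd (fun e => 1 - y ^+ e.+1)) -big_split /=.
by apply: eq_bigr => i _; rewrite -exprM mulnC muln2 doubleS.
Qed.

Lemma theta3_mul y : y ^+ M = 0 ->
  theta3 y * theta3 (- y) = theta3 (- y ^+ 2) ^+ 2.
Proof.
move=> y0; have Ny0 : (- y) ^+ M = 0 by rewrite exprNn y0 mulr0.
have y20 : (y ^+ 2) ^+ M = 0 by rewrite -exprM mulnC exprM y0 expr0n.
rewrite -[in theta3 y](opprK y) !gauss_theta // sqrrN (qfact_even_odd y20).
by rewrite -(oddprod_mul y); ring.
Qed.

Lemma qfact_theta3 y : y ^+ M = 0 -> qfact y n ^+ 2 = theta3 (- y) * qfact (y ^+ 2) n.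
Proof. by move=> y0; rewrite gauss_theta // qfact_even_odd //; ring. Qed.

Lemma exprN4 (z : A) : (- z) ^+ 4 = z ^+ 4. Proof. by rewrite !(exprM _ 2 2) sqrrN. Qed.
Lemma exprN8 (z : A) : (- z) ^+ 8 = z ^+ 8. Proof. by rewrite !(exprM _ 2 4) sqrrN. Qed.

Variable im : A.
Hypothesis im2 : im ^+ 2 = -1.

(* Replacing y by im * y turns theta3_mul into a formula for theta3 (y ^+ 2). *)
Lemma theta3_sqrD y : y ^+ M = 0 ->
  theta3 y ^+ 2 + theta3 (- y) ^+ 2 = 2 * theta3 (y ^+ 2) ^+ 2.
Proof.
move=> y0; have Ny0 : (- y) ^+ M = 0 by rewrite exprNn y0 mulr0.
have iy0 : (im * y) ^+ M = 0 by rewrite exprMn y0 mulr0.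
have Niy0 : (- (im * y)) ^+ M = 0 by rewrite exprNn iy0 mulr0.
have im4 : im ^+ 4 = 1 by rewrite (exprM im 2 2) im2 sqrrN expr1n.
have im8 : im ^+ 8 = 1 by rewrite (exprM im 4 2) im4 expr1n.
have -> : theta3 (y ^+ 2) ^+ 2 = theta3 (im * y) * theta3 (- (im * y)).
  by rewrite theta3_mul // exprMn im2 mulN1r opprK.
rewrite (theta3_even_odd y0) (theta3_even_odd Ny0) (theta3_even_odd iy0) (theta3_even_odd Niy0).
rewrite !exprN4 !exprN8 !exprMn im4 im8 !mul1r.
move: (theta3 _) (psi2 _) => a b.
transitivity (2 * (a ^+ 2 - im ^+ 2 * y ^+ 2 * b ^+ 2)); last by ring.
by rewrite im2; ring.
Qed.

Lemma theta3_psi2 y : y ^+ M = 0 -> 2 * (theta3 y * psi2 (y ^+ 2)) = psi2 y ^+ 2.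
Proof.
move=> y0; have y20 : (y ^+ 2) ^+ M = 0 by rewrite -exprM mulnC exprM y0 expr0n.
apply: (lregM (lreg_qfact (n := n) y0) (lreg_qfact (n := n) y0)); rewrite -expr2.
have E1 := qfact_theta3 y0; have E2 := qfact_theta3 y20.
have P1 := gauss_psi y0; have P2 := gauss_psi y20.
have V := theta3_mul y0.
transitivity (2 * (theta3 y * theta3 (- y)) * (psi2 (y ^+ 2) * qfact (y ^+ 2) n)).
  by rewrite E1; ring.
rewrite P2 V; transitivity (4 * (qfact (y ^+ 2) n ^+ 2) ^+ 2); first by rewrite E2; ring.
by transitivity ((psi2 y * qfact y n) ^+ 2); [rewrite P1 | ]; ring.
Qed.

(** With a, b the values at y and -y, the parity splitting evaluates a - b and a + b, and
    [theta3_sqrD] evaluates a^2 + b^2. Two uses of [theta3_psi2], at y^4 and at y^2, then collapse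
    the product. *)
Lemma theta3_pow4B y : y ^+ M = 0 ->
  theta3 y ^+ 4 - theta3 (- y) ^+ 4 = y * psi2 (y ^+ 2) ^+ 4.
Proof.
move=> y0; have Ny0 : (- y) ^+ M = 0 by rewrite exprNn y0 mulr0.
have pw0 j : (y ^+ j.+1) ^+ M = 0 by rewrite -exprM mulnC exprM y0 expr0n.
have -> : theta3 y ^+ 4 - theta3 (- y) ^+ 4 =
  (theta3 y - theta3 (- y)) * (theta3 y + theta3 (- y)) * (theta3 y ^+ 2 + theta3 (- y) ^+ 2) by ring.
rewrite theta3_sqrD // (theta3_even_odd y0) (theta3_even_odd Ny0) exprN4 exprN8.
have T2 := theta3_psi2 (pw0 1%N); have T4 := theta3_psi2 (pw0 3%N).
rewrite -!exprM in T2 T4.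
transitivity (y * (2 * (2 * (theta3 (y ^+ 4) * psi2 (y ^+ 8)))) * 2 * theta3 (y ^+ 2) ^+ 2); first by ring.
rewrite T4; transitivity (y * (2 * (theta3 (y ^+ 2) * psi2 (y ^+ 4))) ^+ 2); first by ring.
by rewrite T2; ring.
Qed.

(** The 24th powers are (b e)^12 and (a e)^12, with a, b the theta values at y and -y and e the
    product at y^2. The identity a^12 - b^12 = (a^4 - b^4)^3 + 3 (a b)^4 (a^4 - b^4) reduces
    everything to Jacobi's identity and [theta3_mul]. *)
Lemma delta_hecke2 y : y ^+ M = 0 ->
  y * qfact y n ^+ 24 - y * qfact (- y) n ^+ 24 =
  - (48 * (y ^+ 2 * qfact (y ^+ 2) n ^+ 24)) - 2 ^+ 12 * (y ^+ 4 * qfact (y ^+ 4) n ^+ 24).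
Proof.
move=> y0; have Ny0 : (- y) ^+ M = 0 by rewrite exprNn y0 mulr0.
have y20 : (y ^+ 2) ^+ M = 0 by rewrite -exprM mulnC exprM y0 expr0n.
have E1 := qfact_theta3 y0; have E1' := qfact_theta3 Ny0; have E2 := qfact_theta3 y20.
have P2 := gauss_psi y20; have V := theta3_mul y0; have C4 := theta3_pow4B y0.
rewrite opprK sqrrN in E1'; rewrite -[y ^+ 2 ^+ 2]exprM (_ : (2 * 2)%N = 4%N) // in E2 P2.
have pw z : z ^+ 24 = (z ^+ 2) ^+ 12 :> A by rewrite -exprM.
rewrite (pw (qfact y n)) (pw (qfact (- y) n)) E1 E1' {E1 E1' Ny0 y0 y20}.
move: (theta3 y) (theta3 (- y)) (theta3 (- y ^+ 2)) (psi2 (y ^+ 2)) V C4 P2 E2.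
move: (qfact (y ^+ 2) n) (qfact (y ^+ 4) n) => e f a b t p V C4 P2 E2.
transitivity (- (y * e ^+ 12 * ((a ^+ 4 - b ^+ 4) ^+ 3 + 3 * (a * b) ^+ 4 * (a ^+ 4 - b ^+ 4)))).
  by ring.
rewrite C4 V.
transitivity (- (y ^+ 4 * (p * e) ^+ 12) - 3 * y ^+ 2 * t ^+ 8 * (p * e) ^+ 4 * e ^+ 8).
  by ring.
rewrite P2; transitivity (- (2 ^+ 12 * y ^+ 4 * f ^+ 24) - 48 * y ^+ 2 * (t * f) ^+ 8 * e ^+ 8).
  by ring.
by rewrite -E2; ring.
Qed.

(** The eighth power of the left side is 2^8 times the product defining tau, and the right side
    visibly has coefficients of polynomial growth. *)
Lemma qfact_pow3 y : y ^+ M = 0 -> 2 * qfact y n ^+ 3 = theta3 (- y) ^+ 2 * psi2 y.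
Proof.
move=> y0; apply: (lreg_qfact (n := n) y0).
have E1 := qfact_theta3 y0; have P1 := gauss_psi y0.
transitivity (2 * (qfact y n ^+ 2) ^+ 2); first by ring.
rewrite E1; transitivity (theta3 (- y) ^+ 2 * (2 * qfact (y ^+ 2) n ^+ 2)); first by ring.
by rewrite -P1; ring.
Qed.

End Theta.

(** * From identities modulo X^(m+1) to the values of tau *)

Definition truncC (m : nat) : {rmorphism {poly int} -> {poly %/ ('X^(m.+1) : {poly algC})}} :=
  [the {rmorphism {poly int} -> {poly %/ ('X^(m.+1) : {poly algC})}} of
     in_qpoly ('X^(m.+1) : {poly algC}) \o map_poly intr].

Lemma truncC_eq0 (m : nat) (p : {poly int}) : truncC m p = 0 ->
  forall i, (i <= m)%N -> p`_i = 0.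
Proof.
move=> /(congr1 val) /= E i le_im; rewrite mk_monic_Xn in E.
have := Pdiv.RingMonic.rdivp_eq (monicXn algC m.+1) (map_poly intr p).
move: E => /= ->; rewrite addr0 => /(congr1 (fun q : {poly algC} => q`_i)).
rewrite coefMXn ltnS le_im coef_map /= => /eqP; rewrite intr_eq0; exact: eqP.
Qed.

Lemma truncC_X (m : nat) : truncC m 'X ^+ m.+1 = 0.
Proof.
rewrite -rmorphXn /= map_polyXn; apply: val_inj => /=.
by rewrite mk_monic_Xn Pdiv.RingMonic.rmodpp ?monicXn.
Qed.

Lemma rmorph_qfact (R S : nzRingType) (f : {rmorphism R -> S}) (q : R) (n : nat) :
  f (qfact q n) = qfact (f q) n.
Proof.
by rewrite rmorph_prod; apply: eq_bigr => i _; rewrite rmorphB rmorph1 rmorphXn.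
Qed.

Lemma delta_truncE (n : nat) : delta_trunc n = 'X * qfact 'X n ^+ 24.
Proof. by rewrite /delta_trunc big_add1 big_mkord /qfact -prodrXl. Qed.

Lemma truncC_scale (m : nat) (c : int) (p : {poly int}) :
  truncC m (c *: p) = c%:~R * truncC m p.
Proof.
have cP : c%:P = c%:~R :> {poly int} by rewrite -[in LHS](intz c) (rmorph_int polyC).
by rewrite -mul_polyC rmorphM cP rmorph_int.
Qed.

Lemma truncC_delta_comp (m n : nat) (q : {poly int}) :
  truncC m (delta_trunc n \Po q) = truncC m q * qfact (truncC m q) n ^+ 24.
Proof.
rewrite delta_truncE comp_polyM comp_polyX rmorphM; congr (_ * _).
by rewrite !rmorphXn /= !rmorph_qfact /= comp_polyX.
Qed.

Lemma coef_comp_polyNX (R : comNzRingType) (p : {poly R}) (i : nat) :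
  (p \Po - 'X)`_i = (-1) ^+ i * p`_i.
Proof.
have -> : p \Po - 'X = \poly_(j < size p) ((-1) ^+ j * p`_j).
  rewrite comp_polyE poly_def; apply: eq_bigr => j _.
  have -> : (- 'X) ^+ j = ((-1) ^+ j)%:P * 'X^j :> {poly R}.
    by rewrite [LHS]exprNn polyC_exp polyCN.
  by rewrite mul_polyC scalerA mulrC.
by rewrite coef_poly; case: ltnP => // le; rewrite nth_default ?mulr0.
Qed.

Lemma tau_hecke2 (k : nat) :
  tau k.*2 = - 24 * tau k - 2 ^+ 11 * (if odd k then 0 else tau k./2).
Proof.
pose m := k.*2; pose n := m.+1.*2; pose D := delta_trunc n.
have Dtau i : (i <= n)%N -> D`_i = tau i by move=> le; apply: coef_delta_trunc.
(* The first two terms double the even part of [D], so the coefficient of X^(2k) is 2 tau(2k) + 48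
   tau(k), plus 2^12 tau(k/2) when k is even. *)
pose P := D + (D \Po - 'X) + (48 : int) *: (D \Po 'X^2) + (2 ^+ 12 : int) *: (D \Po 'X^4).
have le_n : (m.+1 + m.+1 <= n)%N by rewrite addnn.
have P0 : truncC m P = 0.
  have y0 := truncC_X m.
  have i2 : in_qpoly ('X^(m.+1) : {poly algC}) ('i%:P) ^+ 2 = -1.
    by rewrite -rmorphXn -rmorphXn /= sqrCi !rmorphN !rmorph1.
  have := delta_hecke2 le_n i2 y0.
  have DX : truncC m D = truncC m 'X * qfact (truncC m 'X) n ^+ 24.
    by rewrite -truncC_delta_comp comp_polyXr.
  have tX j : truncC m 'X^j = truncC m 'X ^+ j by rewrite rmorphXn.
  rewrite /P !rmorphD !truncC_scale DX !truncC_delta_comp rmorphN !tX mulNr => ->.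
  rewrite (rmorphXn intr); ring.
have := truncC_eq0 P0 (leqnn m).
rewrite /P !coefD !coefZ coef_comp_polyNX !coef_comp_poly_Xn //.
rewrite -signr_odd odd_double expr0 mul1r.
have -> : (2 %| m)%N by rewrite /m; lia.
have -> : (4 %| m)%N = ~~ odd k by rewrite /m; lia.
have -> : (m %/ 2 = k)%N by rewrite /m; lia.
have -> : (m %/ 4 = k./2)%N by rewrite /m; lia.
have km : (k <= m)%N by rewrite /m; lia.
have mn : (m <= n)%N by rewrite /n; lia.
rewrite !Dtau //; try lia.
rewrite if_neg exprS. case: ifP => _; nra.
Qed.

(** The values of tau at powers of 2 with 8^k removed: 24 / 8 = 3 and 2^11 / 8^2 = 32. After this
    normalization all terms of positive index are odd. *)
Fixpoint lucas (n : nat) : int :=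
  match n with
  | 0 => 0
  | 1 => 1
  | (n'.+1 as p).+1 => - 3 * lucas p - 32 * lucas n'
  end.

Lemma lucasSS n : lucas n.+2 = - 3 * lucas n.+1 - 32 * lucas n.
Proof. by []. Qed.

Lemma tau_pow2_mul (h k : nat) : odd h -> tau (2 ^ k * h) = 8 ^+ k * lucas k.+1 * tau h.
Proof.
move=> oh; have [//] : tau (2 ^ k * h) = 8 ^+ k * lucas k.+1 * tau h /\
  tau (2 ^ k.+1 * h) = 8 ^+ k.+1 * lucas k.+2 * tau h.
elim: k => [|k [IH1 IH2]].
  by rewrite mul1n expn1 mul2n tau_hecke2 oh mulr0 subr0 /= !mul1r.
split=> //; have E j : (2 ^ j.+1 * h = (2 ^ j * h).*2)%N by rewrite expnS -mulnA mul2n.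
rewrite E tau_hecke2 IH2 E odd_double doubleK IH1 (lucasSS k.+1).
move: (lucas k.+2) (lucas k.+1) => u v; rewrite !exprS; ring.
Qed.

(** * Polynomial growth of tau *)

Definition coef_bound (c e : nat) (p : {poly int}) :=
  forall i, (absz (p`_i)%R <= c * i.+1 ^ e)%N.

Lemma coef_boundM c1 c2 e1 e2 p q : coef_bound c1 e1 p -> coef_bound c2 e2 q ->
  coef_bound (c1 * c2) (e1 + e2).+1 (p * q).
Proof.
move=> bp bq i; rewrite coefM.
have -> : (c1 * c2 * i.+1 ^ (e1 + e2).+1 = \sum_(j < i.+1) (c1 * i.+1 ^ e1) * (c2 * i.+1 ^ e2))%N.
  by rewrite sum_nat_const card_ord expnS expnD; ring.
elim/big_ind2: _ => // [x1 x2 y1 y2 l1 l2|j _]; first by lia.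
rewrite abszM; apply: leq_mul.
  apply: leq_trans (bp j) _; rewrite leq_mul2l; apply/orP; right.
  by case: e1 {bp} => // e; rewrite leq_exp2r.
apply: leq_trans (bq (i - j)%N) _; rewrite leq_mul2l; apply/orP; right.
by case: e2 {bq} => // e; rewrite leq_exp2r // ltnS leq_subr.
Qed.

Lemma coef_boundX c e p k : coef_bound c e p ->
  coef_bound (c ^ k.+1) (k.+1 * e + k) (p ^+ k.+1).
Proof.
move=> bp; elim: k => [|k IH]; first by rewrite mul1n addn0 expn1 expr1.
rewrite exprS expnS (_ : k.+2 * e + k.+1 = (e + (k.+1 * e + k)).+1)%N; last by lia.
exact: coef_boundM.
Qed.

(** An exponent e k can equal i only if k <= i + 1, which leaves at most i + 2 <= 2 (i + 1)
    indices. *)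
Lemma coef_bound_sum (n : nat) (x : {poly int}) (e : nat -> nat) :
  x = 'X \/ x = - 'X -> (forall k, (k <= (e k).+1)%N) ->
  coef_bound 2 1 (\sum_(k < n) x ^+ e k).
Proof.
move=> xE ek i; rewrite coef_sum expn1.
apply: (@leq_trans (\sum_(k < n) (k <= i.+1))%N); last first.
  suff : (\sum_(k < n) (k <= i.+1) <= minn n i.+2)%N by lia.
  elim: n => [|n IH]; first by rewrite big_ord0.
  rewrite big_ord_recr /=; apply: (leq_trans (leq_add IH (leqnn _))).
  by case: leqP; lia.
elim/big_ind2: _ => // [x1 x2 y1 y2 l1 l2|k _]; first by lia.
have : (absz ((x ^+ e k)`_i)%R <= (i == e k))%N.
  case: xE => ->; first by rewrite coefXn; case: (i == e k).
  rewrite exprNn -polyC1 -polyCN -polyC_exp coefCM coefXn abszM abszX /= exp1n mul1n.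
  by case: (i == e k).
move/leq_trans; apply; case: eqP => // ->; by rewrite ek.
Qed.

Lemma coef_boundD c1 c2 e p q : coef_bound c1 e p -> coef_bound c2 e q ->
  coef_bound (c1 + c2) e (p + q).
Proof. by move=> bp bq i; have := bp i; have := bq i; rewrite coefD mulnDl; lia. Qed.

Lemma rmorph_theta3 (R S : comNzRingType) (f : {rmorphism R -> S}) (n : nat) (x : R) :
  f (theta3 n x) = theta3 n (f x).
Proof.
by rewrite rmorphD !rmorph_sum; congr (_ + _); apply: eq_bigr => i _; rewrite rmorphXn.
Qed.

Lemma rmorph_psi2 (R S : comNzRingType) (f : {rmorphism R -> S}) (n : nat) (x : R) :
  f (psi2 n x) = psi2 n (f x).
Proof.
by rewrite rmorphD !rmorph_sum; congr (_ + _); apply: eq_bigr => i _; rewrite rmorphXn.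
Qed.

(** The theta factors have growth exponent 1, and each multiplication adds the exponents plus 1: 3
    for T^2, 5 for T^2 S, and 8 * 5 + 7 = 47 for its eighth power. *)
Lemma tau_le (k : nat) : (2 ^ 8 * absz (tau k.+1) <= (4 ^ 2 * 4) ^ 8 * k.+1 ^ 47)%N.
Proof.
pose m := k.+1; pose n := m.+1.*2.
pose T : {poly int} := theta3 n (- 'X); pose S : {poly int} := psi2 n 'X.
have bT : coef_bound 4 1 T.
  apply: (@coef_boundD 2 2); [apply: (@coef_bound_sum _ _ (fun k => k ^ 2)%N) |
    apply: (@coef_bound_sum _ _ (fun k => k.+1 ^ 2)%N)]; try by right.
    by move=> j; rewrite -mulnn; nia.
  by move=> j; rewrite -mulnn; nia.
have bS : coef_bound 4 1 S.
  apply: (@coef_boundD 2 2); [apply: (@coef_bound_sum _ _ (fun k => 'C(k, 2))) |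
    apply: (@coef_bound_sum _ _ (fun k => 'C(k.+2, 2)))]; try by left.
    by move=> j; have := bin2_double j; nia.
  by move=> j; have := bin2_double j.+2; nia.
have bG : coef_bound ((4 ^ 2 * 4) ^ 8) 47 ((T ^+ 2 * S) ^+ 8).
  have b2 := @coef_boundM _ _ _ _ _ _ (@coef_boundX 4 1 _ 1 bT) bS.
  exact: (coef_boundX 7 b2).
have le_n : (m.+1 + m.+1 <= n)%N by rewrite addnn.
have le_kn : (k.+1 <= n)%N by rewrite /n /m; lia.
have P0 : truncC m ((2 ^+ 8 : int) *: delta_trunc n - 'X * (T ^+ 2 * S) ^+ 8) = 0.
  have fT : truncC m T = theta3 n (- truncC m 'X) by rewrite rmorph_theta3 rmorphN.
  have fS : truncC m S = psi2 n (truncC m 'X) by rewrite rmorph_psi2.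
  have E3 := qfact_pow3 le_n (truncC_X m).
  rewrite rmorphB truncC_scale -{1}[delta_trunc n]comp_polyXr truncC_delta_comp.
  rewrite (rmorphM (truncC m) 'X) (rmorphXn (truncC m) 8) (rmorphM (truncC m) (T ^+ 2)).
  rewrite (rmorphXn (truncC m) 2) fT fS -E3.
  have -> : (2 ^+ 8)%:~R = 2 ^+ 8 :> {poly %/ ('X^(m.+1) : {poly algC})} by rewrite rmorphXn.
  by ring.
have := truncC_eq0 P0 (leqnn m).
rewrite coefB coefZ coef_delta_trunc; last exact: le_kn.
rewrite coefXM /= => /eqP; rewrite subr_eq0 => /eqP E.
have := bG k; rewrite -E abszM abszX.
exact.
Qed.

(** * The Lucas sequence *)

Lemma lucas_add (m n : nat) :
  lucas (m + n.+1) = lucas m.+1 * lucas n.+1 - 32 * lucas m * lucas n.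
Proof.
have [//] : lucas (m + n.+1) = lucas m.+1 * lucas n.+1 - 32 * lucas m * lucas n /\
   lucas (m.+1 + n.+1) = lucas m.+2 * lucas n.+1 - 32 * lucas m.+1 * lucas n.
elim: m => [|m [IH1 IH2]]; first by rewrite !lucasSS /=; split; ring.
split=> //; rewrite (addSn m.+1) (lucasSS (m + n.+1)) -!addSn IH1 IH2 !lucasSS; ring.
Qed.

(** The left side is the norm of the n-th power of a root of X^2 + 3X + 32, whose norm is 32. *)
Lemma lucas_norm (n : nat) :
  lucas n.+1 ^+ 2 + 3 * lucas n.+1 * lucas n + 32 * lucas n ^+ 2 = 32 ^+ n.
Proof.
elim: n => [|n IH]; first by rewrite /=; ring.
by rewrite [RHS]exprS -IH !lucasSS; ring.
Qed.

Lemma lucas_odd (n : nat) : odd (absz (lucas n.+1)).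
Proof.
by elim: n => // n; rewrite lucasSS; move: (lucas n.+1) (lucas n) => a b; lia.
Qed.

Lemma lucas_le (n : nat) : (absz (lucas n) <= 8 ^ n)%N.
Proof.
have [//] : (absz (lucas n) <= 8 ^ n)%N /\ (absz (lucas n.+1) <= 8 ^ n.+1)%N.
elim: n => // n [IH1 IH2]; split=> //; rewrite lucasSS.
move: (lucas n.+1) (lucas n) IH1 IH2 => a b; rewrite !expnS; lia.
Qed.

Section OddPrime.
Variables (q : nat).
Hypotheses (q_pr : prime q) (q_odd : odd q).

Lemma coprime_lucasS (d : nat) : (q %| absz (lucas d))%N -> ~~ (q %| absz (lucas d.+1))%N.
Proof.
move=> qd; apply/negP => qd1.
have : (q%:Z %| 32 ^+ d)%Z.
  by rewrite -lucas_norm !expr2 !rpredD ?dvdz_mull // dvdzE.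
rewrite dvdzE abszX /= Euclid_dvdX // => /andP[q32 _].
have : (q %| 2 ^ 5)%N by [].
by rewrite Euclid_dvdX // andbT dvdn_prime2 // => /eqP E; move: q_odd; rewrite E.
Qed.

Lemma coprime_lucas_const (d : nat) : (q %| absz (lucas d))%N ->
  ~~ (q %| absz (lucas d.+1 + 3 * lucas d)%R)%N.
Proof.
move=> qd; apply: contra (coprime_lucasS qd) => qs.
have -> : lucas d.+1 = (lucas d.+1 + 3 * lucas d) - 3 * lucas d by ring.
change (q%:Z %| lucas d.+1 + 3 * lucas d - 3 * lucas d)%Z.
by rewrite rpredB ?dvdz_mull.
Qed.

(* With w ^ d = a w + b for a root w of X^2 + 3X + 32, the expansion of
   (a w + b) ^ k modulo a ^ 3. *)
Lemma lucas_mul_expand (d k : nat) :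
  let a := lucas d.+1 in let b := lucas d.+2 + 3 * lucas d.+1 in
  exists u, lucas (k * d.+1) =
    a * (k%:Z * b ^+ k.-1 - 3 * 'C(k, 2)%:Z * a * b ^+ k.-2 + u * a ^+ 2).
Proof.
move=> a b.
have [u [v [Eu _]]] : exists u v,
  lucas (k * d.+1) = k%:Z * a * b ^+ k.-1 - 3 * 'C(k, 2)%:Z * a ^+ 2 * b ^+ k.-2 + u * a ^+ 3 /\
  lucas (k * d.+1).+1 + 3 * lucas (k * d.+1) = b ^+ k - 32 * 'C(k, 2)%:Z * a ^+ 2 * b ^+ k.-2 + v * a ^+ 3.
  elim: k => [|k [u [v [Eu Ev]]]].
    by exists 0, 0; rewrite mul0n bin_small //= mul0r; split; ring.
  have hb1 : k%:Z * b ^+ k.-1 * b = k%:Z * b ^+ k.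
    by case: (k) => [|j]; rewrite ?mul0r // -mulrA -exprSr.
  have hb2 : 'C(k, 2)%:Z * b ^+ k.-2 * b = 'C(k, 2)%:Z * b ^+ k.-1.
    by case: (k) => [|[|j]]; rewrite ?mul0r // -mulrA -exprSr.
  have EA : lucas (k.+1 * d.+1) = (lucas (k * d.+1).+1 + 3 * lucas (k * d.+1)) * a
      - 3 * lucas (k * d.+1) * a + lucas (k * d.+1) * b.
    rewrite mulSn addnC lucas_add /a /b lucasSS; ring.
  have EB : lucas (k.+1 * d.+1).+1 + 3 * lucas (k.+1 * d.+1) =
      (lucas (k * d.+1).+1 + 3 * lucas (k * d.+1)) * b - 32 * lucas (k * d.+1) * a.
    rewrite EA mulSn addnC -addnS lucas_add /a /b; ring.
  exists (- 23 * 'C(k, 2)%:Z * b ^+ k.-2 + v * a - 3 * u * a + u * b).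
  exists (v * b + 96 * 'C(k, 2)%:Z * b ^+ k.-2 - 32 * u * a).
  have kS : k.+1%:Z = k%:Z + 1 by rewrite -addn1 PoszD.
  rewrite EB EA Ev Eu binS bin1 PoszD kS (exprSr b k) /=.
  clear EA EB Eu Ev kS.
  move: (b ^+ k.-1) (b ^+ k.-2) (b ^+ k) ('C(k, 2)%:Z) (k%:Z) hb1 hb2.
  move=> B1 B2 B0 C K hb1 hb2; split.
    transitivity (B0 * a - 32 * C * a ^+ 3 * B2 + v * a ^+ 4 - 3 * K * a ^+ 2 * B1
      + 9 * C * a ^+ 3 * B2 - 3 * u * a ^+ 4 + a * (K * B1 * b) - 3 * a ^+ 2 * (C * B2 * b)
      + u * a ^+ 3 * b); first by ring.
    by rewrite hb1 hb2; ring.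
  transitivity (B0 * b - 32 * a ^+ 2 * (C * B2 * b) + v * a ^+ 3 * b
     - 32 * K * a ^+ 2 * B1 + 96 * C * a ^+ 3 * B2 - 32 * u * a ^+ 4); first by ring.
  by rewrite hb2; ring.
exists u; rewrite Eu; ring.
Qed.

Lemma logn_absM (a x : int) : ~~ (q %| absz x)%N ->
  logn q (absz (a * x)) = logn q (absz a).
Proof.
by move=> qx; rewrite abszM mulnC logn_Gauss // prime_coprime.
Qed.

Lemma lte_coprime (d k : nat) : (q %| absz (lucas d.+1))%N -> ~~ (q %| k)%N ->
  logn q (absz (lucas (k * d.+1))) = logn q (absz (lucas d.+1)).
Proof.
move=> qd qk; have [u ->] := lucas_mul_expand d k.
have := coprime_lucas_const qd; set b := lucas d.+2 + _; set a := lucas d.+1 in qd * => qb.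
apply: logn_absM; apply/negP => H.
have : (q%:Z %| k%:Z * b ^+ k.-1)%Z.
  have -> : k%:Z * b ^+ k.-1 = (k%:Z * b ^+ k.-1 - 3 * 'C(k, 2)%:Z * a * b ^+ k.-2 + u * a ^+ 2) +
     a * (3 * 'C(k, 2)%:Z * b ^+ k.-2 - u * a) by ring.
  by rewrite rpredD // dvdz_mulr // dvdzE.
rewrite dvdzE abszM abszX Euclid_dvdM // Euclid_dvdX // (negPf qk) /= => /andP[E _].
by rewrite E in qb.
Qed.

(** As q is odd it divides 'C(q, 2), and it divides a; hence in the expansion all terms of the
    cofactor of a after q b^(q-1) are divisible by q^2, while q does not divide b. *)
Lemma lte_prime (d : nat) : (q %| absz (lucas d.+1))%N ->
  logn q (absz (lucas (q * d.+1))) = (logn q (absz (lucas d.+1))).+1.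
Proof.
move=> qd; have [u ->] := lucas_mul_expand d q.
have := coprime_lucas_const qd; set b := lucas d.+2 + _; set a := lucas d.+1 in qd * => qb.
have [c Ea] : exists c, a = c * q%:Z by apply/dvdzP; rewrite dvdzE.
have [j Ej] : exists j, 'C(q, 2) = (j * q)%N.
  by apply/dvdnP; apply: prime_dvd_bin; case: (q) q_pr q_odd => [|[|[|]]].
have -> : q%:Z * b ^+ q.-1 - 3 * 'C(q, 2)%:Z * a * b ^+ q.-2 + u * a ^+ 2 =
  q%:Z * (b ^+ q.-1 - q%:Z * (3 * j%:Z * c * b ^+ q.-2 - u * c ^+ 2)).
  by rewrite Ej PoszM Ea; ring.
rewrite mulrA logn_absM.
  rewrite abszM lognM ?(odd_gt0 (lucas_odd d)) ?(prime_gt0 q_pr) //.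
  by rewrite /= (logn_prime _ q_pr) eqxx addn1.
apply/negP => H.
have : (q%:Z %| b ^+ q.-1)%Z.
  have -> : b ^+ q.-1 = (b ^+ q.-1 - q%:Z * (3 * j%:Z * c * b ^+ q.-2 - u * c ^+ 2)) +
     q%:Z * (3 * j%:Z * c * b ^+ q.-2 - u * c ^+ 2) by ring.
  by rewrite rpredD // dvdz_mulr // dvdzz.
by rewrite dvdzE abszX Euclid_dvdX // => /andP[E _]; rewrite E in qb.
Qed.

Lemma lte (d k : nat) : (0 < d)%N -> (0 < k)%N -> (q %| absz (lucas d))%N ->
  logn q (absz (lucas (k * d))) = (logn q (absz (lucas d)) + logn q k)%N.
Proof.
elim/ltn_ind: k d => k IH [//|d] _ k0 qd.
have [qk|qk] := boolP (q %| k)%N; last first.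
  by rewrite lte_coprime // [logn q k]logn_coprime ?addn0 // prime_coprime.
case/dvdnP: qk => k' Ek; have k'0 : (0 < k')%N by case: k' Ek k0 => // ->.
have q1 := prime_gt1 q_pr.
have qd0 : (0 < q * d.+1)%N by rewrite muln_gt0 prime_gt0.
rewrite Ek -mulnA IH //.
- by rewrite lte_prime // lognM ?(prime_gt0 q_pr) // (logn_prime _ q_pr) eqxx; lia.
- by rewrite Ek ltn_Pmulr.
- have := lte_prime qd; case: (boolP (q %| _)%N) => // nq.
  by rewrite [LHS]logn_coprime // prime_coprime.
Qed.

(** Modulo q, adding z to the index multiplies w_m by w_(z+1) + 3 w_z, which is prime to q. *)
Lemma lucas_rank_mod (z n : nat) : (0 < z)%N -> (q %| absz (lucas z))%N ->
  (q %| absz (lucas n))%N = (q %| absz (lucas (n %% z)))%N.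
Proof.
case: z => // z _ qz; rewrite {1}(divn_eq n z.+1).
elim: (n %/ z.+1)%N => [//|j IH]; rewrite -IH mulSn -addnA addnC.
set m := (j * z.+1 + _)%N; rewrite lucas_add.
have qc := coprime_lucas_const qz.
apply/idP/idP => H.
  have : (q%:Z %| lucas m * (lucas z.+2 + 3 * lucas z.+1))%Z.
    have -> : lucas m * (lucas z.+2 + 3 * lucas z.+1) =
      (lucas m.+1 * lucas z.+1 - 32 * lucas m * lucas z) - lucas m.+1 * lucas z.+1.
      by rewrite lucasSS; ring.
    by rewrite rpredB ?dvdz_mull // dvdzE.
  by rewrite dvdzE abszM Euclid_dvdM // (negPf qc) orbF.
change (q%:Z %| lucas m.+1 * lucas z.+1 - 32 * lucas m * lucas z)%Z.
apply: rpredB; first by rewrite dvdz_mull.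
by rewrite dvdz_mulr // dvdz_mull // dvdzE.
Qed.

End OddPrime.

(** * The law of apparition *)

Lemma pchar_root_lucas (q : nat) : prime q ->
  exists (L : fieldType) (x : L), q \in [pchar L] /\ x ^+ 2 + 3 * x + 32 = 0.
Proof.
move=> q_pr; pose p : {poly 'F_q} := 'X^2 + (3%:P * 'X + 32%:P).
have sp : size p = 3%N.
  rewrite size_polyDl size_polyXn // ltnS.
  apply: leq_trans (size_polyD _ _) _; rewrite geq_max (leq_trans (size_polyC_leq1 _)) // andbT.
  by rewrite mulrC (leq_trans (size_polyMleq _ _)) // size_polyX; case: size (size_polyC_leq1 (3 : 'F_q)) => [|[]].
have p0 : p != 0 by rewrite -size_poly_gt0 sp.
have [L [zs Ezs _]] := FinSplittingFieldFor p0.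
have szs : size zs = 2%N.
  have := eqp_size Ezs; rewrite size_prod_XsubC size_map_poly sp => -[<-] //.
case: zs szs Ezs => // x zs _ Ezs.
exists L, x; split; first by rewrite pchar_lalg pchar_Fp.
have /eqP : root (map_poly (in_alg L) p) x.
  by rewrite (eqp_root Ezs) root_prod_XsubC mem_head.
rewrite rmorphD /= map_polyXn rmorphD rmorphM /= !map_polyC map_polyX => E.
rewrite -[RHS]E hornerD hornerXn hornerD hornerM !hornerC hornerX /= !scaler_nat.
exact/esym/addrA.
Qed.

(** Frobenius permutes the roots x, x' of X^2 + 3X + 32 in characteristic q. If it fixes them, both
    have (q-1)-st power 1; if it swaps them, both have (q+1)-st power x x'. Binet's formula then
    gives the divisibility. *)
Lemma lucas_apparition (q : nat) : prime q -> odd q ->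
  exists2 e, e \in [:: q.-1; q; q.+1] & (q %| absz (lucas e))%N.
Proof.
move=> q_pr q_odd; have [L [x [qL xE]]] := pchar_root_lucas q_pr.
have dvdE n : (lucas n)%:~R = 0 :> L -> (q %| absz (lucas n))%N.
  by move=> E; rewrite -[(_ %| _)%N]/((q%:Z %| lucas n)%Z) (dvdz_pcharf qL) E.
pose x' := - 3 - x; have xx' : x * x' = 32 by rewrite /x'; apply/eqP; rewrite -subr_eq0 -oppr_eq0 -xE; apply/eqP; ring.
have x'E : x' ^+ 2 + 3 * x' + 32 = 0 by rewrite -xE /x'; ring.
have N32 : 32 != 0 :> L.
  have -> : 32 = 2%:R ^+ 5 :> L by rewrite -natrX.
  rewrite expf_neq0 // -(dvdn_pcharf qL) dvdn_prime2 //.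
  by apply: contraL q_odd => /eqP ->.
have [x0 x'0] : x != 0 /\ x' != 0 by apply/andP; rewrite -negb_or -mulf_eq0 xx'.
pose F : {rmorphism L -> L} := [the {rmorphism L -> L} of pFrobenius_aut qL].
have FE z : F z = z ^+ q by rewrite /F /= pFrobenius_autE.
have Fx' : F x' = - 3 - F x by rewrite /x' rmorphB rmorphN rmorph_nat.
have : (F x - x) * (F x - x') = 0.
  have := congr1 F xE; rewrite 2!rmorphD rmorph0 rmorphXn rmorphM !rmorph_nat => E.
  transitivity (F x ^+ 2 + 3 * F x + x * x'); first by rewrite /x'; ring.
  by rewrite xx' E.
have binet n : (x - x') * (lucas n)%:~R = x ^+ n - x' ^+ n.
  have [//] : (x - x') * (lucas n)%:~R = x ^+ n - x' ^+ n /\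
     (x - x') * (lucas n.+1)%:~R = x ^+ n.+1 - x' ^+ n.+1.
  elim: n => [|n [IH1 IH2]]; first by rewrite /= mulr0 subrr mulr1 !expr1.
  split=> //; rewrite lucasSS rmorphB !rmorphM /=.
  transitivity (- 3 * ((x - x') * (lucas n.+1)%:~R) - 32 * ((x - x') * (lucas n)%:~R)).
    by rewrite rmorphN; ring.
  rewrite IH1 IH2.
  transitivity (x ^+ n * (- 3 * x - 32) - x' ^+ n * (- 3 * x' - 32)); first by rewrite !exprS; ring.
  have e1 : x ^+ 2 = - 3 * x - 32 by apply/eqP; rewrite -subr_eq0 -xE; apply/eqP; ring.
  have e2 : x' ^+ 2 = - 3 * x' - 32 by apply/eqP; rewrite -subr_eq0 -x'E; apply/eqP; ring.
  by rewrite -e1 -e2 -!exprD !addn2.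
(* For a double root Binet's formula degenerates to x w_n = n x^n, which vanishes at n = q. *)
have [Exx' _|Nxx'] := eqVneq x x'.
  exists q; first by rewrite !inE eqxx orbT.
  apply: dvdE; apply: (mulfI x0); rewrite mulr0.
  have -> : x * (lucas q)%:~R = q%:R * x ^+ q.
    have [//] : x * (lucas q)%:~R = q%:R * x ^+ q /\ x * (lucas q.+1)%:~R = q.+1%:R * x ^+ q.+1.
    elim: (q) => [|n [IH1 IH2]]; first by rewrite /= mulr0 mul0r mulr1 mul1r expr1.
    split=> //; rewrite lucasSS rmorphB !rmorphM /=.
    transitivity (- 3 * (x * (lucas n.+1)%:~R) - 32 * (x * (lucas n)%:~R)).
      by rewrite rmorphN; ring.
    rewrite IH1 IH2; have e3 : - 3 = x + x by rewrite {2}Exx' /x'; ring.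
    by rewrite e3 -xx' -Exx' -[n.+2]addn2 -[n.+1]addn1 !natrD !exprD; ring.
  by rewrite pcharf0 // mul0r.
have Nd : x - x' != 0 by rewrite subr_eq0.
move/eqP; rewrite mulf_eq0 !subr_eq0 => /orP[] /eqP Fx.
  exists q.-1; first by rewrite !inE eqxx.
  apply: dvdE; apply: (mulfI Nd); rewrite binet mulr0.
  have E1 z : z != 0 -> F z = z -> z ^+ q.-1 = 1.
    move=> z0; rewrite FE -{1}(prednK (prime_gt0 q_pr)) exprS => /(canRL (mulKf z0)).
    by rewrite mulVf.
  by rewrite !E1 ?subrr // Fx' Fx.
exists q.+1; first by rewrite !inE eqxx !orbT.
apply: dvdE; apply: (mulfI Nd); rewrite binet mulr0 !exprS -!FE Fx' Fx /x'; ring.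
Qed.

Local Close Scope ring_scope.

(** For even n the difference factors as (2^(n/2) - x)(2^(n/2) + x) and is at least 2^(n/2); only
    odd n needs the Pade argument. *)
Theorem pow2_square_gap (n x : nat) :
  2 ^ 13 <= n -> x ^ 2 < 2 ^ n -> 2 ^ n <= (2 ^ n - x ^ 2) ^ 50.
Proof.
move=> le_n; rewrite -(odd_double_half n); case: (odd n) (odd_double_half n) => En.
  rewrite add1n; move: (n./2) En => k En.
  (* 2642 = 7 + 85 * 31, which provides s >= 31. *)
  have k_ge : 2642 <= k by move: le_n; rewrite -En; lia.
  apply: (@gap_odd_large algR ((k - 7) %/ 85) ((k - 7) %% 85)).
  - lia.
  - by rewrite ltn_mod.
  - by rewrite mulnC -addnA -divn_eq subnKC //; lia.
rewrite add0n -muln2 expnM => lt.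
have {lt} lt : x < 2 ^ n./2 by rewrite -(@ltn_exp2r _ _ 2).
rewrite subn_sqr.
apply: (@leq_trans ((2 ^ n./2) ^ 50)); first by rewrite leq_pexp2l ?expn_gt0.
rewrite leq_exp2r // (leq_trans (leq_addr x _)) //.
by rewrite leq_pmull // subn_gt0.
Qed.

(** * A cube-root bound for the number of divisors *)

Lemma size_divisors_part (p N : nat) : prime p -> 0 < N ->
  size (divisors N) <= (logn p N).+1 * size (divisors N`_p^').
Proof.
move=> p_pr N0.
have -> : (logn p N).+1 * size (divisors N`_p^') =
    size [seq p ^ i * d | i <- iota 0 (logn p N).+1, d <- divisors N`_p^'].
  by rewrite size_allpairs size_iota.
apply: uniq_leq_size; first exact: divisors_uniq.
move=> d; rewrite -dvdn_divisors // => dN.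
have d0 : 0 < d by apply: dvdn_gt0 dN.
apply/allpairsP; exists (logn p d, d`_p^'); split.
- by rewrite mem_iota leq0n add0n ltnS dvdn_leq_log.
- by rewrite -dvdn_divisors ?part_gt0 // partn_dvd.
- by rewrite -p_part partnC.
Qed.

Lemma succ_cube_le (e : nat) : e.+1 ^ 3 <= 8 * 2 ^ e.
Proof.
case: e => [|[|[|e]]] //; elim: e => // e IH.
apply: (@leq_trans (2 * e.+4 ^ 3)); first by rewrite !expnS !expn0 !muln1; nia.
by rewrite (expnS _ e.+3) [leqRHS]mulnCA leq_mul2l IH orbT.
Qed.

Lemma succ_cube_le8 (e : nat) : e.+1 ^ 3 <= 8 ^ e.
Proof.
rewrite -[8]/(2 ^ 3) -expnM mulnC expnM leq_exp2r //.
by elim: e => // e IH; rewrite expnS; lia.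
Qed.

(** A prime p >= 8 satisfies (e + 1)^3 <= 8^e <= p^e; each of the four smaller primes costs one
    factor 8. Exponent 1/3 suffices, since the divisor count is later multiplied by about sqrt N and
    a power of log N. *)
Lemma size_divisors_cube (N : nat) : 0 < N -> size (divisors N) ^ 3 <= 8 ^ 4 * N.
Proof.
have prime_ge8 r : prime r -> r \notin [:: 2; 3; 5; 7] -> 8 <= r.
  by case: r => [|[|[|[|[|[|[|[|]]]]]]]].
pose c N := count (fun p => p %| N) [:: 2; 3; 5; 7].
suff H : 0 < N -> size (divisors N) ^ 3 <= 8 ^ c N * N.
  move=> N0; apply: leq_trans (H N0) _; rewrite leq_mul2r; apply/orP; right.
  by apply: leq_pexp2l => //; apply: count_size.
elim/ltn_ind: N => N IH N0.
have [N1|N1] := leqP N 1; first by have -> : N = 1 by [lia|]; rewrite leq_pmulr ?expn_gt0.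
have p_pr := pdiv_prime N1; set p := pdiv N in p_pr.
have pN : p %| N := pdiv_dvd N; set M := N`_p^'; set e := logn p N.
have NE : p ^ e * M = N by rewrite -p_part partnC.
have M0 : 0 < M by rewrite part_gt0.
have MN : M %| N by apply: dvdn_part.
have e0 : 0 < e by rewrite logn_gt0 mem_primes p_pr N0.
have pM : ~~ (p %| M).
  apply/negP => pM; have := part_pnat p^' N; rewrite -/M => /pnatP.
  by move=> /(_ M0 p p_pr pM); rewrite !inE eqxx.
have ltM : M < N.
  by rewrite -NE -[X in X < _]mul1n ltn_pmul2r // -(expn0 p) ltn_exp2l // prime_gt1.
have := IH M ltM M0 => {}IH.
apply: (@leq_trans (e.+1 ^ 3 * (8 ^ c M * M))).
  apply: leq_trans (_ : (e.+1 * size (divisors M)) ^ 3 <= _); last by rewrite expnMn leq_mul2l IH orbT.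
  by rewrite leq_exp2r // size_divisors_part.
have cMN : c M + (p \in [:: 2; 3; 5; 7]) <= c N.
  rewrite /c /= -!addnA !addn0.
  have le r : (r %| M) + (p == r) <= (r %| N).
    have [<-|_] := eqVneq p r; first by rewrite pN (negPf pM).
    by rewrite addn0; case: (boolP (r %| M)) => // /dvdn_trans ->.
  have := le 2; have := le 3; have := le 5; have := le 7; rewrite !inE.
  move: (p == 2) (p == 3) (p == 5) (p == 7) => [] [] [] []; clear; lia.
apply: (@leq_trans (8 ^ (p \in [:: 2; 3; 5; 7]) * p ^ e * (8 ^ c M * M))).
  rewrite leq_mul2r; apply/orP; right.
  have [pin|pout] := boolP (p \in _).
    by apply: leq_trans (succ_cube_le e) _; rewrite expn1 leq_mul2l leq_exp2r ?prime_gt1 ?orbT.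
  rewrite mul1n; apply: leq_trans (succ_cube_le8 e) _; rewrite leq_exp2r //.
  exact: prime_ge8.
rewrite mulnACA -expnD NE leq_mul2r [_ + c M]addnC.
by apply/orP; right; apply: leq_pexp2l.
Qed.

(** * Lucas numbers dividing a factorial *)

Lemma leq_sum_range (m n : nat) (F G : nat -> nat) :
  (forall i, m <= i < n -> F i <= G i) ->
  \sum_(m <= i < n) F i <= \sum_(m <= i < n) G i.
Proof.
by move=> le; rewrite big_nat_cond [leqRHS]big_nat_cond; apply: leq_sum => i /andP[/le].
Qed.

(** Each dyadic block of j contributes at most m. *)
Lemma sum_divn_le (m L J : nat) : J <= 2 ^ L -> \sum_(1 <= j < J) m %/ j <= m * L.
Proof.
move=> leJ; apply: (@leq_trans (\sum_(1 <= j < 2 ^ L) m %/ j)).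
  have [J1|J1] := leqP J 1; first by rewrite big_geq.
  by rewrite [leqRHS](big_cat_nat (n := J)) ?(ltnW J1) //= leq_addr.
elim: L {J leJ} => [|L IH]; first by rewrite big_geq.
have p2 : 0 < 2 ^ L by rewrite expn_gt0.
rewrite (big_cat_nat (n := 2 ^ L)) //=; last by rewrite leq_exp2l.
rewrite mulnS addnC; apply: leq_add => //.
apply: (@leq_trans (\sum_(2 ^ L <= j < 2 ^ L.+1) m %/ 2 ^ L)).
  apply: leq_sum_range => j /andP[le _]; exact: leq_div2l.
by rewrite sum_nat_const_nat expnS mul2n -addnn addnK mulnC leq_divM.
Qed.

Lemma logn_fact_le (q n L : nat) : prime q -> n < 2 ^ L ->
  logn q n`! <= L * (n %/ q).
Proof.
move=> q_pr ltn; rewrite logn_fact //.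
apply: (@leq_trans (\sum_(1 <= k < n.+1) (k <= L) * (n %/ q))).
  apply: leq_sum_range => k /andP[k0 _].
  have [le|gt] := leqP k L; rewrite ?mul1n ?mul0n.
    by apply: leq_div2l; rewrite ?prime_gt0 // -{1}(expn1 q) leq_exp2l // prime_gt1.
  rewrite leqn0 divn_small //; apply: (leq_trans ltn).
  by apply: (@leq_trans (2 ^ k)); rewrite ?leq_exp2l ?leq_exp2r // ?(ltnW gt) // prime_gt1.
rewrite -big_distrl /= leq_mul2r; apply/orP; right.
elim: n {ltn} => [|n IH]; first by rewrite big_geq.
suff : \sum_(1 <= k < n.+2) (k <= L) <= minn n.+1 L by lia.
elim: n.+1 => [|k IHk]; first by rewrite big_geq.
by rewrite big_nat_recr //=; lia.
Qed.

Lemma lucas_rank (q n : nat) : prime q -> odd q -> 0 < n -> q %| absz (lucas n) ->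
  exists z, [/\ 0 < z, q %| absz (lucas z) &
    forall m, (q %| absz (lucas m)) = (z %| m)].
Proof.
move=> q_pr q_odd n0 qn.
have ex : exists d, (0 < d) && (q %| absz (lucas d)) by exists n; rewrite n0.
case: (ex_minnP ex) => z /andP[z0 qz] zmin; exists z; split=> // m.
rewrite (lucas_rank_mod q_pr q_odd m z0 qz).
apply/idP/idP => [H|/eqP -> //=].
rewrite /dvdn -leqn0 leqNgt; apply/negP => m0.
by have := zmin _ (introT andP (conj m0 H)); rewrite leqNgt ltn_mod z0.
Qed.

Definition small_rank (D : nat) : nat_pred :=
  [pred q | has (fun d => q %| absz (lucas d)) (iota 1 D)].

(** By lifting the exponent, a prime of rank z <= D occurs in w_N as often as in w_z and in N / z
    together; the factor d = z of the product covers the first part and N the second. *)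
Lemma small_rank_part_dvd (N D : nat) : 0 < N ->
  (absz (lucas N))`_(small_rank D) %| N * \prod_(d <- divisors N | d <= D) absz (lucas d).
Proof.
move=> N0; set W := absz (lucas N).
have W_odd : odd W by rewrite /W -(prednK N0) lucas_odd.
have lucas_gt0 d : 0 < d -> 0 < absz (lucas d) by move=> d0; rewrite -(prednK d0) odd_gt0 ?lucas_odd.
have P0 : 0 < \prod_(d <- divisors N | d <= D) absz (lucas d).
  rewrite big_seq_cond; apply: prodn_cond_gt0 => d /andP[dN _].
  by apply: lucas_gt0; move: dN; rewrite -dvdn_divisors // => /dvdn_gt0; apply.
apply/dvdn_partP; first by rewrite part_gt0.
move=> p; rewrite mem_primes => /and3P[p_pr _ pW].
have psm : p \in small_rank D.
  have := part_pnat (small_rank D) W => /pnatP; rewrite part_gt0 => /(_ isT p p_pr); exact.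
have pW' : p %| W := dvdn_trans pW (dvdn_part _ _).
have p_odd : odd p by apply: dvdn_odd pW' W_odd.
rewrite p_part pfactor_dvdn // ?muln_gt0 ?N0 //.
have [z [z0 pz zE]] := lucas_rank p_pr p_odd N0 pW'.
have zN : z %| N by rewrite -zE.
have zD : z <= D.
  move: psm => /hasP[d]; rewrite mem_iota zE => /andP[d0 dD] /(dvdn_leq d0) le.
  by apply: leq_trans le _; rewrite add1n ltnS in dD.
rewrite lognM //.
apply: (@leq_trans (logn p W)).
  by apply: dvdn_leq_log; rewrite ?lucas_gt0 // dvdn_part.
have Nz0 : 0 < N %/ z by rewrite divn_gt0 // dvdn_leq.
have -> : logn p W = logn p (absz (lucas z)) + logn p (N %/ z).
  by rewrite -(lte p_pr p_odd z0 Nz0 pz) divnK.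
rewrite addnC; apply: leq_add.
  by apply: dvdn_leq_log => //; rewrite -{2}(divnK zN) dvdn_mulr.
apply: dvdn_leq_log => //.
rewrite big_mkcond (bigD1_seq z) /= ?divisors_uniq -?dvdn_divisors // zD.
exact: dvdn_mulr.
Qed.

(** A prime q of rank z > D satisfies q + 1 = z j + e with e < 3, and n / q <= 2 n / (z j) because z
    j <= q + 1 <= 2 q. A triple (z, j, e) determines q, and the sum over j costs the factor L. *)
Lemma large_rank_sum_le (N D L n : nat) (s : seq nat) :
  0 < N -> 0 < D -> n.+2 <= 2 ^ L -> uniq s ->
  (forall q, q \in s -> [/\ prime q, odd q, q <= n, q %| absz (lucas N) & q \notin small_rank D]) ->
  \sum_(q <- s) n %/ q <= 3 * size (divisors N) * ((2 * n) %/ D * L).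
Proof.
move=> N0 D0 nL s_uniq sP.
pose ds := [seq z <- divisors N | D < z].
pose G z j := (2 * n) %/ (z * j).
have cover q : q \in s -> n %/ q <=
    \sum_(z <- ds) \sum_(1 <= j < n.+2) \sum_(e < 3) (q.+1 == z * j + e) * G z j.
  move=> qs; have [q_pr q_odd q_le qN qD] := sP q qs.
  have [z [z0 qz zE]] := lucas_rank q_pr q_odd N0 qN.
  have [e e_in qe] := lucas_apparition q_pr q_odd.
  have q2 := prime_gt1 q_pr.
  have zN : z %| N by rewrite -zE.
  have [j Ej] : exists j, e = j * z by apply/dvdnP; rewrite -zE.
  have e_bounds : [/\ 0 < e, e <= q.+1 & q.+1 <= e + 2].
    by move: e_in; rewrite !inE => /or3P[] /eqP ->; split; lia.
  have [e0 e1 e2] := e_bounds.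
  have j0 : 0 < j by case: j Ej e0 => // ->.
  have jn : j < n.+2.
    by rewrite ltnS (leq_trans _ (leq_trans e1 (_ : q.+1 <= n.+1))) // Ej leq_pmulr.
  have zD : z \in ds.
    rewrite mem_filter -dvdn_divisors // zN andbT ltnNge; apply/negP => zD.
    by move/hasP: qD; apply; exists z => //; rewrite mem_iota z0 add1n ltnS.
  have lt3 : q.+1 - e < 3 by lia.
  rewrite (bigD1_seq z) ?filter_uniq ?divisors_uniq //=.
  apply: leq_trans (leq_addr _ _).
  rewrite (bigD1_seq j) ?iota_uniq ?mem_index_iota ?j0 //=.
  apply: leq_trans (leq_addr _ _).
  rewrite (bigD1 (Ordinal lt3)) //=; apply: leq_trans (leq_addr _ _).
  rewrite [z * j]mulnC -Ej subnKC // eqxx mul1n /G [z * j]mulnC -Ej.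
  rewrite -(@divnMl 2) //; apply: leq_div2l => //.
  by apply: leq_trans e1 _; lia.
apply: (@leq_trans (\sum_(q <- s) \sum_(z <- ds) \sum_(1 <= j < n.+2)
    \sum_(e < 3) (q.+1 == z * j + e) * G z j)).
  by rewrite big_seq [leqRHS]big_seq; apply: leq_sum => q /cover.
rewrite exchange_big /=.
apply: (@leq_trans (\sum_(z <- ds) 3 * ((2 * n) %/ D * L))); last first.
  rewrite big_const_seq iter_addn_0 count_predT mulnAC [_ * size _]mulnC leq_mul2r.
  by apply/orP; right; rewrite mulnC leq_mul2l /= size_filter count_size.
rewrite big_seq [leqRHS]big_seq. apply: leq_sum => z; rewrite mem_filter => /andP[Dz _].
rewrite exchange_big /=.
apply: (@leq_trans (\sum_(1 <= j < n.+2) 3 * G z j)).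
  apply: leq_sum => j _; rewrite exchange_big /=.
  apply: (@leq_trans (\sum_(e < 3) G z j)); last by rewrite sum_nat_const card_ord.
  apply: leq_sum => e _; rewrite -big_distrl /= -[leqRHS]mul1n leq_mul2r; apply/orP; right.
  apply: (@leq_trans (count_mem (z * j + e).-1 s)); last by rewrite count_uniq_mem // leq_b1.
  rewrite -sum1_count [leqRHS]big_mkcond /=; apply: leq_sum => q _; case: eqP => // E.
  by rewrite -E eqxx.
rewrite -big_distrr leq_mul2l /=.
apply: (@leq_trans (\sum_(1 <= j < n.+2) ((2 * n) %/ z) %/ j)).
  by apply: leq_sum => j _; rewrite /G divnMA.
apply: (leq_trans (sum_divn_le _ nL)); rewrite leq_mul2r; apply/orP; right.
by apply: leq_div2l => //; apply: ltnW.
Qed.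

(** The first two exponents bound the part of small rank, using |w_d| <= 8^D. In the last one, the
    first L bounds log q, the second comes from the exponent of q in n!, and the third from the
    harmonic sum. *)
Lemma lucas_dvd_fact_le (N D L n : nat) :
  0 < N -> 0 < D -> N < 2 ^ L -> n.+2 <= 2 ^ L -> absz (lucas N) %| n`! ->
  absz (lucas N) <= 2 ^ (L + 3 * (D * size (divisors N)) +
     L * (L * (3 * size (divisors N) * ((2 * n) %/ D * L)))).
Proof.
move=> N0 D0 NL nL; set W := absz (lucas N) => Wn.
have W_odd : odd W by rewrite /W -(prednK N0) lucas_odd.
have W0 : 0 < W by apply: odd_gt0.
have nL' : n < 2 ^ L by apply: leq_trans nL; rewrite ltnS leqW.
rewrite -(partnC (small_rank D) W0) (expnD 2 (L + _)) (expnD 2 L); apply: leq_mul.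
  have sm := small_rank_part_dvd D N0.
  have P0 : 0 < N * \prod_(d <- divisors N | d <= D) absz (lucas d).
    rewrite muln_gt0 N0 big_seq_cond; apply: prodn_cond_gt0 => d /andP[dN _].
    have d0 : 0 < d by move: dN; rewrite -dvdn_divisors // => /dvdn_gt0; apply.
    by rewrite -(prednK d0) odd_gt0 ?lucas_odd.
  apply: (leq_trans (dvdn_leq P0 sm)); apply: leq_mul; first exact: ltnW.
  rewrite (expnM 2 3) (_ : 2 ^ 3 = 8) //.
  apply: (@leq_trans (\prod_(d <- divisors N) 8 ^ D)); last first.
    by rewrite big_const_seq count_predT iter_muln_1 -expnM.
  rewrite big_mkcond /=; elim/big_ind2: _ => // [x1 x2 y1 y2|d _]; first exact: leq_mul.
  case: ifP => [le|_]; last by rewrite expn_gt0.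
  by apply: (leq_trans (lucas_le d)); apply: leq_pexp2l.
pose s := [seq q <- primes W | q \notin small_rank D].
have sP q : q \in s -> [/\ prime q, odd q, q <= n, q %| W & q \notin small_rank D].
  rewrite mem_filter mem_primes => /andP[qD /and3P[q_pr _ qW]]; split=> //.
    by apply: dvdn_odd qW W_odd.
  have : q %| n`! by apply: dvdn_trans qW Wn.
  rewrite leqNgt; apply: contraL => lt; rewrite fact_prod Euclid_dvd_prod //.
  rewrite big_has; apply/hasPn => i; rewrite mem_index_iota => /andP[i0 lei].
  by rewrite gtnNdvd // (leq_trans lei).
have s_uniq : uniq s by rewrite filter_uniq ?primes_uniq.
apply: (@leq_trans (\prod_(q <- s) q ^ logn q W)).
  rewrite /s big_filter {1}/partn.
  rewrite -(filter_pi_of (ltnSn W)) big_filter_cond.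
  rewrite [leqLHS]big_mkcond [leqRHS]big_mkcond /=; apply: leq_prod => p _.
  rewrite inE /= [p \in \pi(W)]mem_primes W0 /= lognE W0 /=.
  by case: (p \in small_rank D); case: (prime p && (p %| W)).
apply: (@leq_trans (\prod_(q <- s) 2 ^ (L * (L * (n %/ q))))).
  rewrite big_seq [leqRHS]big_seq; apply: leq_prod => q /sP[q_pr _ q_le _ _].
  rewrite expnM; apply: (@leq_trans (q ^ (L * (n %/ q)))).
    apply: leq_pexp2l; first exact: prime_gt0.
    apply: leq_trans (logn_fact_le q_pr nL').
    by apply: dvdn_leq_log => //; apply: fact_gt0.
  case: (L * (n %/ q)) => // m; rewrite leq_exp2r //; apply: (leq_trans q_le); exact: ltnW.
rewrite -expn_sum; apply: leq_pexp2l => //.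
rewrite -!big_distrr /= !leq_mul2l; apply/orP; right; apply/orP; right.
exact: large_rank_sum_le.
Qed.

(** * Explicit constants and conclusion *)

Lemma pow18_le (L : nat) : 310 <= L -> L ^ 18 <= 2 ^ (L - 142).
Proof.
move=> L310; pose k := L %/ 18.
have k17 : 17 <= k by rewrite /k; lia.
have Lk : L <= 18 * k.+1 by rewrite /k; lia.
have kL : (k - 8) * 18 <= L - 142 by rewrite /k; lia.
have base j : 18 * (j + 17).+1 <= 2 ^ (j + 17 - 8).
  elim: j => [|j IH]; first by rewrite (_ : 0 + 17 - 8 = 9).
  by rewrite (_ : j.+1 + 17 - 8 = (j + 17 - 8).+1) ?expnS; lia.
apply: (@leq_trans ((2 ^ (k - 8)) ^ 18)); last by rewrite -expnM leq_pexp2l.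
rewrite leq_exp2r //; apply: (leq_trans Lk).
by have := base (k - 17); rewrite subnK.
Qed.

Lemma nat_sqrt_ex (N : nat) : 0 < N -> exists D, [/\ 0 < D, D ^ 2 <= N & N < D.+1 ^ 2].
Proof.
move=> N0; have ex : exists d, d ^ 2 <= N by exists 0.
have ub d : d ^ 2 <= N -> d <= N by rewrite -mulnn; nia.
case: (ex_maxnP ex ub) => D le max; exists D; split=> //.
  by rewrite lt0n; apply/eqP => D0; have := max 1; rewrite exp1n D0; lia.
by rewrite ltnNge; apply/negP => /max; rewrite ltnn.
Qed.

Lemma lucas_smooth_small (N n : nat) :
  0 < N -> 300 <= trunc_log 2 N -> n <= 2 ^ 8 * N -> absz (lucas N) %| n`! ->
  absz (lucas N) ^ 25 <= 2 ^ N.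
Proof.
move=> N0 big nN Wn; pose L := trunc_log 2 N + 10.
have /andP[NL1 NL2] := trunc_log_bounds (isT : 1 < 2) N0.
have [D [D0 DN ND]] := nat_sqrt_ex N0.
pose t := size (divisors N).
have t0 : 0 < t by rewrite /t -has_predT; apply/hasP; exists 1; rewrite // -dvdn_divisors // dvd1n.
have L0 : 310 <= L by rewrite /L; lia.
have NL : N < 2 ^ L.
  by apply: (leq_trans NL2); rewrite leq_pexp2l // /L -addn1 leq_add2l.
have nL : n.+2 <= 2 ^ L.
  rewrite /L expnD; apply: (@leq_trans (2 ^ 8 * (2 ^ (trunc_log 2 N) * 2) + 0)).
    by move: NL2; rewrite expnSr => NL2; lia.
  lia.
have tE : t ^ 3 <= 2 ^ 12 * N by have := size_divisors_cube N0; rewrite -[8 ^ 4]/((2 ^ 3) ^ 4) -expnM.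
have nD : (2 * n) %/ D <= 2 ^ 11 * D.
  have D2 : D.+1 ^ 2 <= 4 * D ^ 2 by rewrite -!mulnn; nia.
  have le : 2 * n <= 2 ^ 11 * D * D by rewrite -mulnn in D2; lia.
  by apply: (leq_trans (leq_div2r D le)); rewrite mulnK.
(* In sixth powers, t^6 <= 2^24 N^2 and D^6 <= N^3 leave 2^132 L^18 <= N to prove; since N >= 2^(L -
   10), this is the source of 142 in [pow18_le]. *)
have key : 2 ^ 18 * (L ^ 3 * t * D) <= N.
  rewrite -(@leq_exp2r _ _ 6) //.
  have -> : (2 ^ 18 * (L ^ 3 * t * D)) ^ 6 = 2 ^ 108 * L ^ 18 * (t ^ 3) ^ 2 * D ^ 6.
    by rewrite -[108]/(18 * 6) (expnM 2); move: (2 ^ 18) => c; ring.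
  have t6 : (t ^ 3) ^ 2 <= 2 ^ 24 * N ^ 2.
    by rewrite -[24]/(12 * 2) (expnM 2) -expnMn leq_exp2r.
  have D6 : D ^ 6 <= N ^ 3 by rewrite -[6]/(2 * 3) expnM leq_exp2r.
  have L18 : 2 ^ 132 * L ^ 18 <= N.
    apply: leq_trans NL1; apply: (@leq_trans (2 ^ 132 * 2 ^ (L - 142))).
      by rewrite leq_mul2l pow18_le ?orbT.
    by rewrite -expnD leq_pexp2l // /L; lia.
  apply: (@leq_trans (2 ^ 108 * L ^ 18 * (2 ^ 24 * N ^ 2) * N ^ 3)).
    by apply: leq_mul => //; apply: leq_mul.
  rewrite [leqRHS](_ : _ = N * (N ^ 2 * N ^ 3)); last by ring.
  apply: (@leq_trans (2 ^ 132 * L ^ 18 * (N ^ 2 * N ^ 3))); last by rewrite leq_mul2r L18 orbT.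
  rewrite -[132]/(108 + 24) expnD.
  by move: (2 ^ 108) (2 ^ 24) => c1 c2; rewrite leq_eqVlt; apply/orP; left; apply/eqP; ring.
have := lucas_dvd_fact_le N0 D0 NL nL Wn; rewrite -/t.
set X := L + _ + _ => WX.
apply: (@leq_trans ((2 ^ X) ^ 25)); first by rewrite leq_exp2r.
rewrite -expnM leq_pexp2l //; apply: leq_trans key.
have u0 : 1 <= t * D by rewrite muln_gt0 t0.
(* The coefficients add up to 6148, and 25 * 6148 < 2^18. *)
have X2 : X <= L ^ 3 * t * D + 3 * (L ^ 3 * t * D) + 3 * 2 ^ 11 * (L ^ 3 * t * D).
  have L3 : L <= L ^ 3 by rewrite -[leqLHS]expn1 leq_pexp2l //; lia.
  have L30 : 0 < L ^ 3 by apply: leq_trans L3; lia.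
  rewrite /X; apply: leq_add; first apply: leq_add.
  - by rewrite -mulnA; apply: leq_trans L3 _; rewrite leq_pmulr.
  - by rewrite leq_mul2l /= -mulnA [D * t]mulnC leq_pmull.
  rewrite [leqLHS](_ : _ = L ^ 3 * 3 * t * ((2 * n) %/ D)); last by ring.
  rewrite [leqRHS](_ : _ = L ^ 3 * 3 * t * (2 ^ 11 * D)).
    by rewrite leq_mul2l nD orbT.
  by move: (2 ^ 11) => c; ring.
move: (L ^ 3 * t * D) X2 => U X2; lia.
Qed.

Lemma exp_fact_le (m k : nat) : m`! ^ k <= (k * m)`!.
Proof.
elim: k => // k IH; rewrite expnS mulSn.
apply: (@leq_trans (m`! * (k * m)`!)); first by rewrite leq_mul2l IH orbT.
rewrite -(bin_fact (leq_addr (k * m) m)) addKn.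
by rewrite leq_pmull // bin_gt0 leq_addr.
Qed.

Lemma fact_mul_exp2_le (a b : nat) : 0 < a -> 2 ^ b * a`! <= (a + b)`!.
Proof.
move=> a0; elim: b => [|b IH]; first by rewrite mul1n addn0.
by rewrite addnS factS expnS -mulnA leq_mul //; lia.
Qed.

Lemma lucas_pow2_norm (N : nat) : exists x : nat,
  x ^ 2 + 119 * absz (lucas N) ^ 2 = 2 ^ (5 * N + 2).
Proof.
have absz_sqr (z : int) : Posz (absz z ^ 2) = (z ^+ 2)%R.
  by rewrite -abszX gez0_abs // sqr_ge0.
exists (absz (2 * lucas N.+1 + 3 * lucas N)%R); apply/eqP.
rewrite -eqz_nat PoszD PoszM !absz_sqr (_ : Posz (2 ^ _) = (2 ^+ (5 * N + 2))%R).
  rewrite exprD exprM -[(2 ^+ 5)%R]/(Posz 32) -lucas_norm; apply/eqP; ring.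
by rewrite -natrX natz.
Qed.

Lemma factorial_pow2_part (m : nat) : 0 < m -> exists N h,
  [/\ m`! = 2 ^ N.-1 * h, odd h, 0 < N & m <= 2 * N].
Proof.
move=> m0; exists (logn 2 m`!).+1, (m`!)`_2^'; split=> //.
- by rewrite -p_part partnC ?fact_gt0.
- rewrite -coprime2n (@pnat_coprime 2) ?part_pnat ?pnat_id //.
have : m %/ 2 <= logn 2 m`!.
  by rewrite logn_fact // big_nat_recl // expn1 leq_addr.
lia.
Qed.

(** The growth bound gives n! <= 2^40 (m!)^47 <= (47 m + 40)!, and 47 m + 40 <= 87 m. *)
Lemma tau_fact_index_le (m n : nat) : 0 < m -> absz (tau m`!) = n`! -> n <= 87 * m.
Proof.
move=> m0 E.
have le : n`! <= 2 ^ 40 * m`! ^ 47.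
  have := tau_le (m`!).-1; rewrite (prednK (fact_gt0 m)) E.
  have -> : (4 ^ 2 * 4) ^ 8 = 2 ^ 8 * 2 ^ 40.
    by rewrite -expnD -[4 ^ 2 * 4]/(2 ^ 6) -expnM.
  have p8 : 0 < 2 ^ 8 by rewrite expn_gt0.
  move: (2 ^ 8) (2 ^ 40) p8 => a b a0; rewrite -mulnA leq_pmul2l //.
have {}le : n`! <= (47 * m + 40)`!.
  apply: (leq_trans le); apply: leq_trans (fact_mul_exp2_le _ _); last by lia.
  by rewrite leq_mul2l exp_fact_le orbT.
have {le} : n <= 47 * m + 40.
  rewrite leqNgt; apply/negP => lt; move: le; rewrite leqNgt => /negP; apply.
  by rewrite ltn_fact //; lia.
lia.
Qed.

Lemma trunc_log_lucas_lt (N n : nat) : 0 < N -> n <= 2 ^ 8 * N ->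
  absz (lucas N) %| n`! -> trunc_log 2 N < 300.
Proof.
move=> N0 nN Wn; rewrite ltnNge; apply/negP => big.
have small := lucas_smooth_small N0 big nN Wn.
have [x xE] := lucas_pow2_norm N.
have W0 : 0 < absz (lucas N) by rewrite -(prednK N0) odd_gt0 ?lucas_odd.
have N13 : 2 ^ 13 <= N.
  have /andP[+ _] := trunc_log_bounds (isT : 1 < 2) N0.
  by apply: leq_trans; rewrite leq_pexp2l // (leq_trans _ big).
have le13 : 2 ^ 13 <= 5 * N + 2 by move: (2 ^ 13) N13 => c; lia.
have lt : x ^ 2 < 2 ^ (5 * N + 2).
  by rewrite -xE -addn1 leq_add2l muln_gt0 expn_gt0 W0.
have := pow2_square_gap le13 lt; rewrite -[in X in X - _]xE addKn.
rewrite leqNgt => /negP; apply.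
(* With 119 <= 2^7 the 50th power is at most 2^(350 + 4 N), which N >= 350 keeps below 2^(5 N +
   2). *)
rewrite expnMn -expnM -[2 * 50]/(25 * 4) expnM.
apply: (@leq_ltn_trans ((2 ^ 7) ^ 50 * (2 ^ N) ^ 4)).
  by apply: leq_mul; rewrite leq_exp2r.
rewrite -!expnM -expnD ltn_exp2l //.
have N350 : 350 <= N by apply: leq_trans N13; lia.
lia.
Qed.

(** Effectivity is expressed by the sigma type: the bound is data, and the witness is an explicit
    number. *)
Theorem theorem4 :
  {B : nat | forall m n : nat, (0 < m)%N -> (0 < n)%N ->
     `|tau m`!|%N = n`! -> (m <= B)%N /\ (n <= B)%N}.
Proof.
(* N <= 2^300 gives m <= 2 N <= 2^301, and n <= 87 m. *)
exists (87 * 2 ^ 301) => m n m0 _ E.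
have n_le := tau_fact_index_le m0 E.
have [N [h [fE h_odd N0 m_le]]] := factorial_pow2_part m0.
have Wn : absz (lucas N) %| n`!.
  rewrite -E fE tau_pow2_mul // prednK // !abszM.
  by apply: dvdn_mulr; apply: dvdn_mull.
have n_le' : n <= 2 ^ 8 * N by lia.
have small := trunc_log_lucas_lt N0 n_le' Wn.
have /andP[_ N_lt] := trunc_log_bounds (isT : 1 < 2) N0.
have {N_lt small} N_le : N <= 2 ^ 300.
  by apply: leq_trans (ltnW N_lt) _; rewrite leq_pexp2l.
have : m <= 2 ^ 301.
  by apply: (leq_trans m_le); rewrite (expnS 2 300) leq_mul2l.
by move: (2 ^ 301) => c; lia.
Qed.
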